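(* Let $d\ge 2$ and $\alpha\in(0,1)$. There exist constants $c>0$ and $N$ such that the following holds. Consider the Poisson observation model with parameter $n$, and for a binwidth $\varepsilon$ let $\varphi_{\chi^2}$ be the $\varepsilon$-chi-squared test, which rejects (equals $1$) when $\mathcal{K}_\varepsilon>t_\alpha$ and equals $0$ otherwise, where the threshold $t_\alpha$ is chosen such that $\mathbb{E}_{P_0,P_0}[\varphi_{\chi^2}]\le\alpha$. If $n\ge N$ and $$\eta\le c\,n^{-2/(3d)},$$ then there exist alternatives $(P,Q)\in\mathcal{P}_\eta$ against which $\mathbb{E}_{P,Q}[\varphi_{\chi^2}]\le 2/(z^\alpha)^2$.
   Context: The constants $c,N$ do not depend on $n,\varepsilon,\eta,t_\alpha$. $z^\alpha$ is the $(1-\alpha)$ quantile of the standard normal distribution (the bound $2/(z^\alpha)^2$ is read as $+\infty$ if $z^\alpha=0$). Poisson observation model: $n_1,n_2$ are independent $\mathrm{Pois}(n)$ random variables; given these, $X_1,\dots,X_{n_1}$ are i.i.d. from $P$ and $Y_1,\dots,Y_{n_2}$ are i.i.d. from $Q$, independently. $\mathbb{E}_{P,Q}$ denotes expectation under this model. Partitions: let $\Omega=(0,1)^d$. For $\eta\in(0,1)$ with $M=1/\eta$ an integer, $\Xi_\eta$ is the partition of $\Omega$ into the cubes $\Delta_j=\frac jM+(-\eta,0]^d$, $j\in\{1,\dots,M\}^d$ (intersected with $\Omega$). Chi-squared-type statistic: $\mathcal{K}_\varepsilon=\sum_{\Delta\in\Xi_\varepsilon}\big(n_1P_{n_1}(\Delta)-n_2Q_{n_2}(\Delta)\big)^2$,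 where $n_1P_{n_1}(\Delta)=\#\{i\le n_1:X_i\in\Delta\}$ and $n_2Q_{n_2}(\Delta)=\#\{j\le n_2:Y_j\in\Delta\}$. Spatially localized alternatives: for $\Delta_j\in\Xi_\eta$ let $\Delta_j^L=\frac jM+(-\eta,-\frac\eta2]^d$, $\Delta_j^R=\frac jM+(-\frac\eta2,0]^d$, $\phi_{\Delta_j}(x)=\mathbf 1(x\in\Delta_j^L)-\mathbf 1(x\in\Delta_j^R)$, and let $P_{\Delta_j}$ be the distribution on $\Omega$ with density $1+\frac12\phi_{\Delta_j}$. Let $P_0=\mathrm{Unif}(\Omega)$ and $\mathcal{P}_\eta=\{(P_0,P_{\Delta_j}):\Delta_j\in\Xi_\eta\}$.
   Formalization: The bound 2/(z^α)^2 is read as +∞ whenever z^α ≤ 0 (α ≥ 1/2), not only when z^α = 0; with the literal bound the claim fails for α near 1 (e.g. α = 0.99, where 2/(z^α)^2 < 0.37 while the power can be close to α). *)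

(* Defs.v *)
From HB Require Import structures.
From mathcomp Require Import all_boot all_order all_algebra.
From mathcomp Require Import all_classical all_reals all_analysis.
From mathcomp Require Import measurable_realfun ring lra.

Set Implicit Arguments.
Unset Strict Implicit.
Unset Printing Implicit Defensive.

Import Order.TTheory GRing.Theory Num.Theory.
Import numFieldNormedType.Exports.

Local Open Scope classical_set_scope.
Local Open Scope ring_scope.

Section iid.
Context d (T : measurableType d) (R : realType).

Definition cons_pair k (p : T * k.-tuple T) : k.+1.-tuple T :=
  [tuple of p.1 :: p.2].

Lemma measurable_cons_pair k : measurable_fun [set: T * k.-tuple T] (@cons_pair k).
Proof. exact: measurable_cons measurable_fst measurable_snd. Qed.

HB.instance Definition _ k :=
  isMeasurableFun.Build _ _ _ _ (@cons_pair k) (@measurable_cons_pair k).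

(* The product probability P^{\otimes k}, i.e. the law of (X_1, ..., X_k) with
   X_1, ..., X_k i.i.d. from P; see [iid_box]. *)
Fixpoint iid (P : probability T R) k : probability (k.-tuple T) R :=
  match k with
  | 0 => dirac [tuple] : probability _ R
  | k.+1 => distribution (P \x iid P k)%E (@cons_pair k) : probability _ R
  end.

Definition box k (A : 'I_k -> set T) : set (k.-tuple T) :=
  [set x | forall i, A i (tnth x i)].

Lemma measurable_box k (A : 'I_k -> set T) :
  (forall i, measurable (A i)) -> measurable (box A).
Proof.
move=> mA.
have -> : box A = \big[setI/setT]_(i < k) ((fun x => tnth x i) @^-1` A i).
  rewrite -bigcap_seq; apply/seteqP; split => x /= h i.
    by move=> _; exact: h.
  by apply: h; rewrite /= mem_index_enum.
apply: bigsetI_measurable => i _; rewrite -[X in measurable X]setTI.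
exact: measurable_tnth.
Qed.

Lemma iid_box (P : probability T R) k (A : 'I_k -> set T) :
  (forall i, measurable (A i)) ->
  iid P k (box A) = (\prod_(i < k) P (A i))%E.
Proof.
elim: k A => [|k IH] A mA.
  by rewrite big_ord0 /= diracE mem_set// => -[].
rewrite big_ord_recl -IH => [|i]; last exact: mA.
rewrite -product_measure1E//; last by apply: measurable_box => i; exact: mA.
rewrite /= /distribution /pushforward; congr (_ _).
apply/seteqP; split => -[x y] /=.
  move=> h; split; first by have := h ord0.
  by move=> i; have := h (lift ord0 i); rewrite tnthS.
by move=> [hx hy] i; case: (unliftP ord0 i) => [j ->|->] //=; rewrite tnthS.
Qed.

End iid.

Section model.
Context {R : realType} {d : nat}.

Local Notation point := (d.-tuple (measurableTypeR R)).
Local Notation sample := (seq point).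
Local Notation law := (probability point R).

(* The expectation of f(X_1, ..., X_{n1}; Y_1, ..., Y_{n2}) in the Poisson
   observation model. The second argument of [poisson_prob] is a dummy. *)
Definition expect (n : R) (P Q : law) (f : sample -> sample -> R) : \bar R :=
  (\int[poisson_prob n 0 \x poisson_prob n 0]_k
     \int[iid P k.1 \x iid Q k.2]_s (f s.1 s.2)%:E)%E.

Definition omega : set point :=
  @box _ (measurableTypeR R) d (fun=> `]0, 1[%classic).

(* An index j in {1, ..., M}^d is encoded by j : d.-tuple 'I_M, whose
   coordinates are one less; [vertex j i] is the i-th coordinate of j/M. *)
Definition vertex M (j : d.-tuple 'I_M) (i : 'I_d) : R := (tnth j i).+1%:R / M%:R.

(* j/M + (-a, -b]^d *)
Definition shifted_cube M (j : d.-tuple 'I_M) (a b : R) : set point :=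
  @box _ (measurableTypeR R) d (fun i => `]vertex j i - a, vertex j i - b]%classic).

Definition cell M (j : d.-tuple 'I_M) : set point :=
  omega `&` shifted_cube j M%:R^-1 0.

Definition cellL M (j : d.-tuple 'I_M) : set point :=
  shifted_cube j M%:R^-1 (M%:R^-1 / 2).

Definition cellR M (j : d.-tuple 'I_M) : set point :=
  shifted_cube j (M%:R^-1 / 2) 0.

Definition phi M (j : d.-tuple 'I_M) (x : point) : R :=
  \1_(cellL j) x - \1_(cellR j) x.

(* The uniform distribution on (0,1)^d. *)
Definition unif : law := iid (uniform_prob (@ltr01 R)) d.

(* [unif] is the restriction of Lebesgue measure to (0,1)^d, so a density on
   (0,1)^d is a density with respect to [unif]. *)
Definition tilted M (j : d.-tuple 'I_M) (A : set point) : \bar R :=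
  (\int[unif]_(x in A) (1 + 2^-1 * phi j x)%:E)%E.

Lemma measurable_shifted_cube M (j : d.-tuple 'I_M) a b :
  measurable (shifted_cube j a b).
Proof. by apply: measurable_box => i; exact: measurable_itv. Qed.

Lemma uniform_prob_itv (a b : R) : 0 <= a -> a <= b -> b <= 1 ->
  uniform_prob (@ltr01 R) `]a, b] = (b - a)%:E.
Proof.
move=> a0 ab b1; rewrite /uniform_prob.
rewrite (eq_integral (fun=> 1%E)); last first.
  move=> x; rewrite inE/= in_itv/= => /andP[ax xb].
  by rewrite /uniform_pdf (ltW (le_lt_trans a0 ax)) (le_trans xb b1) subr0 invr1.
rewrite integral_cst//= mul1e lebesgue_measure_itv/= lte_fin.
have [->|ne] := eqVneq a b; first by rewrite ltxx subrr.
by rewrite lt_neqAle ne ab -EFinB.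
Qed.

Lemma unif_shifted_cube M (j : d.-tuple 'I_M) a b :
  0 <= b -> b <= a -> a <= M%:R^-1 ->
  unif (shifted_cube j a b) = (\prod_(i < d) (a - b)%:E)%E.
Proof.
move=> b0 ba aM; rewrite /unif /shifted_cube iid_box//; apply: eq_bigr => i _.
have M0 : 0 < M%:R :> R by rewrite ltr0n (leq_ltn_trans _ (ltn_ord (tnth j i))).
rewrite [LHS]uniform_prob_itv; first by congr (_%:E); ring.
- rewrite subr_ge0 (le_trans aM)// /vertex ler_peMl ?invr_ge0 ?ler0n//.
  by rewrite ler1n.
- by rewrite lerD2l lerN2.
- rewrite (@le_trans _ _ (vertex j i))//; first by rewrite gerBl.
  by rewrite /vertex ler_pdivrMr// mul1r ler_nat.
Qed.

Lemma measurable_phi M (j : d.-tuple 'I_M) : measurable_fun setT (phi j).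
Proof.
by apply: measurable_funB; apply: measurable_indic; exact: measurable_shifted_cube.
Qed.

Lemma tilted_density_ge0 M (j : d.-tuple 'I_M) x : 0 <= 1 + 2^-1 * phi j x.
Proof. by rewrite /phi !indicE; case: (x \in _); case: (x \in _) => /=; lra. Qed.

Lemma measurable_tilted_density M (j : d.-tuple 'I_M) :
  measurable_fun setT (fun x => (1 + 2^-1 * phi j x)%:E).
Proof.
apply/measurable_EFinP; apply: measurable_funD => //.
by apply: measurable_funM => //; exact: measurable_phi.
Qed.

Section tilted_probability.
Context M (j : d.-tuple 'I_M).

Let tilted0 : tilted j set0 = 0%E.
Proof. by rewrite /tilted integral_set0. Qed.

Let tilted_ge0 A : (0 <= tilted j A)%E.
Proof. by apply: integral_ge0 => x _; rewrite lee_fin tilted_density_ge0. Qed.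

Let tilted_sigma_additive : semi_sigma_additive (tilted j).
Proof.
move=> F mF tF mUF; rewrite /tilted; apply: cvg_toP.
  apply: ereal_nondecreasing_is_cvgn => m n mn.
  by apply: lee_sum_nneg_natr => // k _ _; exact: tilted_ge0.
rewrite ge0_integral_bigcup//=.
- by apply: measurable_funTS; exact: measurable_tilted_density.
- by move=> x _; rewrite lee_fin tilted_density_ge0.
Qed.

HB.instance Definition _ := isMeasure.Build _ _ _ (tilted j)
  tilted0 tilted_ge0 tilted_sigma_additive.

Let tilted_setT : tilted j [set: point] = 1%E.
Proof.
have mL := measurable_shifted_cube j M%:R^-1 (M%:R^-1 / 2).
have mR := measurable_shifted_cube j (M%:R^-1 / 2) 0.
have M0 : 0 <= M%:R^-1 :> R by rewrite invr_ge0 ler0n.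
have LR : unif (cellL j) = unif (cellR j).
  have [h1 h2] : 0 <= M%:R^-1 / 2 :> R /\ M%:R^-1 / 2 <= M%:R^-1 :> R by lra.
  rewrite !unif_shifted_cube//.
  by apply: eq_bigr => i _; congr (_%:E); lra.
have half (A : set point) : measurable A ->
    (\int[unif]_x (2^-1 * \1_A x)%:E = 2^-1%:E * unif A)%E.
  move=> mA; under eq_integral do rewrite EFinM.
  rewrite ge0_integralZl//; first by rewrite integral_indic// setIT.
  by apply/measurable_EFinP; exact: measurable_indic.
have mhalf (A : set point) : measurable A ->
    measurable_fun [set: point] (fun x => (2^-1 * \1_A x : R)%:E).
  move=> mA; apply/measurable_EFinP; exact: measurable_funM.
have half_ge0 (A : set point) x : (0 <= (2^-1 * \1_A x : R)%:E)%E.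
  by rewrite lee_fin mulr_ge0.
have : (tilted j setT + 2^-1%:E * unif (cellR j) =
        1 + 2^-1%:E * unif (cellL j))%E.
  rewrite -!half// -ge0_integralD//; last 3 first.
  - by move=> x _; rewrite lee_fin tilted_density_ge0.
  - exact: measurable_tilted_density.
  - exact: mhalf.
  rewrite -[X in (X + _)%E](probability_setT unif).
  rewrite -[X in (X + _)%E]mul1e -integral_cst//.
  rewrite -ge0_integralD//; last exact: mhalf.
  apply: eq_integral => x _; rewrite -!EFinD; congr (_%:E).
  by rewrite /phi; ring.
rewrite LR => /(congr1 (fun y => y - 2^-1%:E * unif (cellR j))%E).
by rewrite !addeK// fin_numM// fin_num_measure.
Qed.

HB.instance Definition _ :=
  Measure_isProbability.Build _ _ R (tilted j) tilted_setT.

End tilted_probability.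

(* {(P_0, P_Delta) : Delta a cell of side 1/M} *)
Definition local_alternatives M : set (law * law) :=
  [set (unif, tilted j : law) | j in [set: d.-tuple 'I_M]].

Definition cell_count M (j : d.-tuple 'I_M) (s : sample) : nat :=
  count (mem (cell j)) s.

(* The statistic at binwidth 1/M. *)
Definition chi2_stat M (x y : sample) : R :=
  \sum_(j : d.-tuple 'I_M) ((cell_count j x)%:R - (cell_count j y)%:R) ^+ 2.

Definition chi2_test M (t : R) (x y : sample) : R :=
  if t < chi2_stat M x y then 1 else 0.

End model.

Arguments expect {R d} n P Q f.
Arguments unif {R d}.
Arguments local_alternatives R d M : clear implicits.

Definition normal_quantile {R : realType} (p : R) : R :=
  inf [set z : R | (p%:E <= normal_prob 0 1 `]-oo, z])%E].

(* Main.v *)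
Require Import Defs.
From mathcomp Require Import all_boot all_order all_algebra.
From mathcomp Require Import all_classical all_reals all_analysis.
From mathcomp Require Import measurable_realfun ring lra.

(** Only the cell counts matter to the test.  Under the Poisson model they are
independent; with m cells, the null gives every count the mean l = n / m, and
the alternative changes the means of the second sample to l + e_j, where
sum e_j = 0, sum |e_j| <= n eta^d and, because |e_j| is at most both l and
n eta^d, sum e_j^2 <= l sqrt(m) * n eta^(3d/2).  The condition on eta makes the
last factor a small constant kappa ([expect_power], [tilted_mass_dev],
[sum_tilted_mass_dev]).

A tail bound for the normal law gives alpha <= 1 / z^2 ([level_le_quantile]),
so it suffices to bound the power by 2 alpha.  This is a matter of second
moments ([counts_power_le]).

If m is below a constant, the law of the counts under the alternative is close
in total variation to the law under the null: the chi-squared divergence is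
exp (sum e_j^2 / l) - 1, and sum e_j^2 / l <= kappa sqrt(m)
([power_poisson_shift]).

If m is large, the two laws may be far apart, but their statistics are not.
Letting the two laws share as many points as possible, the statistics differ by
an independent sum whose mean and standard deviation are small compared with
sqrt(n (1 + l)), the order of the standard deviation of the statistic
([alternative_power_shift]).  Hence the power is at most the level of the same
test at a threshold lowered by a small multiple tau of sqrt(n (1 + l)), up to
alpha / 2.  It remains to see that the null law of the statistic is smooth at
the scale tau ([null_power_smooth]).  For this the null is contaminated: in
every cell, with probability delta / sqrt(m), a Poisson (sqrt l) number of points
is added to the first sample.  This law of the counts is close to the null in
total variation, and its statistic exceeds the null one by more than tau with
high probability, by Chebyshev's inequality.  So the null statistic is beyond
the lowered threshold about as rarely as the contaminated one is beyond t, which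
is about as rarely as the null one is beyond t. *)

Set Implicit Arguments.
Unset Strict Implicit.
Unset Printing Implicit Defensive.

Import Order.TTheory GRing.Theory Num.Theory.
Import numFieldNormedType.Exports.

Local Open Scope classical_set_scope.
Local Open Scope ring_scope.

(** * Expectation operators *)
Section operators.
Context {R : realType}.

(** Expectations are handled as functionals of nonnegative extended-real
functions: a joint law of independent variables is a composition of functionals,
and integrands carry no measurability or integrability conditions. *)
Record expectation_op (T : Type) (E : (T -> \bar R) -> \bar R) : Prop := {
  op_le : forall f g, (forall x, 0 <= f x)%E -> (forall x, f x <= g x)%E ->
    (E f <= E g)%E;
  op_add : forall f g, (forall x, 0 <= f x)%E -> (forall x, 0 <= g x)%E ->
    (E (fun x => f x + g x) = E f + E g)%E;
  op_scale : forall (c : R) f, 0 <= c -> (forall x, 0 <= f x)%E ->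
    (E (fun x => c%:E * f x) = c%:E * E f)%E;
  op_one : E (fun=> 1%E) = 1%E }.

Lemma op_ge0 T (E : (T -> \bar R) -> \bar R) f : expectation_op E ->
  (forall x, 0 <= f x)%E -> (0 <= E f)%E.
Proof.
move=> opE f0; apply: (@le_trans _ _ (E (fun=> 0%:E * 1)%E)).
  by rewrite (op_scale opE)// mul0e.
by apply: (op_le opE) => x; rewrite mul0e.
Qed.

Lemma op_cst T (E : (T -> \bar R) -> \bar R) c : expectation_op E ->
  0 <= c -> E (fun=> c%:E) = c%:E.
Proof.
move=> opE c0; transitivity (E (fun=> c%:E * 1)%E).
  by under [in RHS]eq_fun do rewrite mule1.
by rewrite (op_scale opE)// (op_one opE) mule1.
Qed.

Lemma op_bind T U V (E : (T -> \bar R) -> \bar R)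
    (F : T -> (U -> \bar R) -> \bar R) (g : T -> U -> V) :
  expectation_op E -> (forall x, expectation_op (F x)) ->
  expectation_op (fun f => E (fun x => F x (fun y => f (g x y)))).
Proof.
move=> opE opF; split.
- move=> f1 f2 f0 f12; apply: (op_le opE) => x; first exact: op_ge0.
  exact: (op_le (opF x)).
- move=> f1 f2 f10 f20; rewrite -(op_add opE); last 2 first.
  + by move=> x; exact: op_ge0.
  + by move=> x; exact: op_ge0.
  by congr E; apply/funext => x; rewrite (op_add (opF x)).
- move=> c f c0 f0; rewrite -(op_scale opE)//; last by move=> x; exact: op_ge0.
  by congr E; apply/funext => x; rewrite (op_scale (opF x)).
- by rewrite -[RHS](op_one opE); congr E; apply/funext => x; exact: op_one.
Qed.

Section indep.
Context {J T : Type}.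
Implicit Types (E : J -> (T -> \bar R) -> \bar R) (js : seq J).

(** Integrating the coordinates one after the other is what makes every fact
about independence below an induction on the list. *)
Fixpoint indep E js (f : seq T -> \bar R) : \bar R :=
  if js is j :: js' then E j (fun x => indep E js' (fun s => f (x :: s)))
  else f [::].

Lemma op_indep E js : (forall j, expectation_op (E j)) ->
  expectation_op (indep E js).
Proof.
move=> opE; elim: js => [|j js IH] /=.
  by split=> // f g _ fg.
exact: (op_bind (F := fun=> indep E js) (@cons T) (opE j) (fun=> IH)).
Qed.

Lemma indep_tilt E (L : J -> T -> R) js f :
  (forall j, expectation_op (E j)) -> (forall j x, 0 <= L j x) ->
  (forall s, 0 <= f s)%E ->
  indep (fun j g => E j (fun x => (L j x)%:E * g x)%E) js f =
    indep E js (fun s => (\prod_(z <- zip js s) L z.1 z.2)%:E * f s)%E.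
Proof.
move=> opE L0; elim: js f => [|j js IH] f f0 /=; first by rewrite big_nil mul1e.
congr (E j); apply/funext => x; rewrite IH//.
rewrite -(op_scale (op_indep js opE))//; last first.
  by move=> s; rewrite mule_ge0// lee_fin prodr_ge0.
by congr indep; apply/funext => s; rewrite big_cons/= EFinM muleA.
Qed.

Lemma indep_prod E js (g : J -> T -> R) (c : J -> R) :
  (forall j, expectation_op (E j)) -> (forall j x, 0 <= g j x) ->
  (forall j, E j (EFin \o g j) = (c j)%:E) ->
  indep E js (fun s => (\prod_(z <- zip js s) g z.1 z.2)%:E) =
    (\prod_(j <- js) c j)%:E.
Proof.
move=> opE g0 gc.
transitivity (indep (fun j g' => E j (fun x => (g j x)%:E * g' x)%E) js
    (fun=> 1%E)).
  by rewrite indep_tilt//; congr indep; apply/funext => s; rewrite mule1.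
have c0 j : 0 <= c j.
  by rewrite -lee_fin -gc; apply: op_ge0 => // x; rewrite lee_fin.
elim: js => [|j js IH] /=; first by rewrite big_nil.
rewrite IH big_cons EFinM muleC -gc -(op_scale (opE j))//; last 2 first.
- by rewrite prodr_ge0.
- by move=> x; rewrite lee_fin.
by congr (E j); apply/funext => x; rewrite muleC.
Qed.

(** The variance of a sum of independent terms is the sum of the variances.  The
offset c is there for the induction: once a coordinate is integrated last, the
other ones are part of the offset. *)
Lemma indep_sqr E js (w : J -> T -> R) (a v : J -> R) (c : R) :
  (forall j, expectation_op (E j)) -> (forall j, 0 <= v j) ->
  (forall j c, E j (fun x => ((c + w j x) ^+ 2)%:E) <=
     ((c + a j) ^+ 2 + v j)%:E)%E ->
  (indep E js (fun s => ((c + \sum_(z <- zip js s) w z.1 z.2) ^+ 2)%:E) <=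
    ((c + \sum_(j <- js) a j) ^+ 2 + \sum_(j <- js) v j)%:E)%E.
Proof.
move=> opE v0 H; elim: js c => [|j js IH] c /=; first by rewrite !big_nil !addr0.
have V0 : 0 <= \sum_(j <- js) v j by rewrite sumr_ge0.
apply: (@le_trans _ _ (E j (fun x =>
   (((c + \sum_(j <- js) a j) + w j x) ^+ 2)%:E +
   (\sum_(j <- js) v j)%:E)%E)).
  apply: (op_le (opE j)) => x.
    by apply: op_ge0 => [|s]; [exact: op_indep|rewrite lee_fin sqr_ge0].
  rewrite -EFinD addrAC; apply: le_trans (IH (c + w j x)).
  by under eq_fun do rewrite big_cons/= addrA.
rewrite (op_add (opE j)); last 2 first.
- by move=> x; rewrite lee_fin sqr_ge0.
- by move=> x; rewrite lee_fin.
rewrite (op_cst (opE j))//; apply: le_trans (leeD (H _ _) (le_refl _)) _.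
rewrite -EFinD lee_fin !big_cons le_eqVlt; apply/orP; left; apply/eqP; ring.
Qed.

Lemma indep_chebyshev E js (w : J -> T -> R) (a v : J -> R) (k : R) :
  (forall j, expectation_op (E j)) -> (forall j, 0 <= v j) -> 0 < k ->
  (forall j c, E j (fun x => ((c + w j x) ^+ 2)%:E) <=
     ((c + a j) ^+ 2 + v j)%:E)%E ->
  (indep E js (fun s =>
     (k <= `|\sum_(z <- zip js s) w z.1 z.2 - \sum_(j <- js) a j|)%R%:R%:E) <=
    ((\sum_(j <- js) v j) / k ^+ 2)%:E)%E.
Proof.
move=> opE v0 k0 H; have opI := op_indep js opE.
have k2 : 0 < k ^+ 2 by rewrite exprn_gt0.
have := indep_sqr js (- \sum_(j <- js) a j) opE v0 H.
rewrite addNr expr0n add0r => le1.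
apply: (@le_trans _ _ (indep E js (fun s => (k ^+ 2)^-1%:E *
   ((- \sum_(j <- js) a j + \sum_(z <- zip js s) w z.1 z.2) ^+ 2)%:E)%E)).
  apply: (op_le opI) => s; first by rewrite lee_fin.
  rewrite -EFinM lee_fin (addrC (- _)).
  set x := _ - _; case: (leP k `|x|) => kx /=.
    by rewrite mulrC ler_pdivlMr// mul1r -(real_normK (num_real x)) ler_sqr ?nnegrE ?(ltW k0).
  by rewrite mulr_ge0 ?invr_ge0 ?(ltW k2) ?sqr_ge0.
rewrite (op_scale opI); last 2 first.
- by rewrite invr_ge0 ltW.
- by move=> s; rewrite lee_fin sqr_ge0.
rewrite mulrC EFinM; apply: lee_pmul => //.
- by rewrite lee_fin invr_ge0 ltW.
- by apply: op_ge0 => // s; rewrite lee_fin sqr_ge0.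
Qed.

(** Chi-squared divergence bounds total variation.  The second moment of a
product of likelihood ratios is the product of the second moments, so the
hypothesis says that the likelihood ratio P of the whole vector has variance at
most s^2; and P - 1 <= s / 2 + (P - 1)^2 / (2 s). *)
Lemma indep_tilt_le E js (L : J -> T -> R) (c : J -> R) (s : R)
    (A : seq T -> R) :
  (forall j, expectation_op (E j)) -> (forall j x, 0 <= L j x) -> 0 < s ->
  (forall j, E j (EFin \o L j) = 1%E) ->
  (forall j, E j (fun x => (L j x ^+ 2)%:E) = (c j)%:E) ->
  \prod_(j <- js) c j <= 1 + s ^+ 2 ->
  (forall u, 0 <= A u <= 1) ->
  (indep (fun j g => E j (fun x => (L j x)%:E * g x)%E) js (EFin \o A) <=
    indep E js (EFin \o A) + s%:E)%E.
Proof.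
move=> opE L0 s0 L1 L2 cs A01; have opI := op_indep js opE.
have A0 u : 0 <= A u by case/andP: (A01 u).
pose P u := \prod_(z <- zip js u) L z.1 z.2.
have P0 u : 0 <= P u by rewrite prodr_ge0.
have EP : indep E js (EFin \o P) = 1%E.
  rewrite /comp /P (indep_prod js opE L0 (c := fun=> 1))//.
  by rewrite big1_eq.
have EP2 : (indep E js (fun u => (P u ^+ 2)%:E) <= (1 + s ^+ 2)%:E)%E.
  rewrite (_ : (fun u => _) = (fun u => (\prod_(z <- zip js u) L z.1 z.2 ^+ 2)%:E)).
    by rewrite (indep_prod js opE (g := fun j x => L j x ^+ 2) (c := c)) ?lee_fin// => j x; exact: sqr_ge0.
  by apply/funext => u; rewrite /P prodrXl.
have EV : (indep E js (fun u => ((P u - 1) ^+ 2)%:E) <= (s ^+ 2)%:E)%E.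
  rewrite -(leeD2rE (x := (2%:E)%E))//.
  rewrite -[X in (_ + X <= _)%E]mule1 -EP -(op_scale opI) ?ler0n//.
  rewrite -(op_add opI); last 2 first.
  - by move=> u; rewrite lee_fin sqr_ge0.
  - by move=> u; rewrite lee_fin mulr_ge0.
  rewrite (_ : (fun u => _) = (fun u => (P u ^+ 2)%:E + 1%E)%E); last first.
    by apply/funext => u /=; rewrite -EFinM -!EFinD; congr (_%:E); ring.
  rewrite (op_add opI)//; last by move=> u; rewrite lee_fin sqr_ge0.
  rewrite (op_one opI); apply: le_trans (leeD EP2 (le_refl _)) _.
  by rewrite -!EFinD lee_fin; lra.
rewrite indep_tilt//.
apply: (@le_trans _ _ (indep E js (fun u => (A u)%:E +
   ((s / 2)%:E + (2 * s)^-1%:E * ((P u - 1) ^+ 2)%:E))%E)).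
  apply: (op_le opI) => u; first by rewrite /= -EFinM lee_fin mulr_ge0// P0.
  rewrite -/(P u) /comp -!EFinM -!EFinD lee_fin.
  have /andP[a0 a1] := A01 u; set a := A u in a0 a1 *; set p := P u.
  have : (p - 1) * a <= s / 2 + (2 * s)^-1 * (p - 1) ^+ 2.
    have h : `|p - 1| <= s / 2 + (2 * s)^-1 * (p - 1) ^+ 2.
      rewrite -(real_normK (num_real (p - 1))); set y := `|p - 1|.
      rewrite -subr_ge0.
      have -> : s / 2 + (2 * s)^-1 * y ^+ 2 - y = (2 * s)^-1 * (s - y) ^+ 2.
        by field; rewrite gt_eqF.
      by rewrite mulr_ge0 ?sqr_ge0// invr_ge0 mulr_ge0 ?ltW.
    apply: le_trans h; apply: le_trans (ler_norm _) _.
    by rewrite normrM (ger0_norm a0) ler_piMr.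
  by nra.
have V0 u : (0 <= ((P u - 1) ^+ 2)%:E)%E by rewrite lee_fin sqr_ge0.
have i0 : 0 <= (2 * s)^-1 by rewrite invr_ge0 mulr_ge0 ?(ltW s0).
rewrite (op_add opI); last 2 first.
- by move=> u; rewrite lee_fin.
- by move=> u; rewrite adde_ge0 ?mule_ge0// lee_fin ?divr_ge0 ?ltW.
apply: leeD => //; rewrite (op_add opI); last 2 first.
- by move=> u; rewrite lee_fin divr_ge0 ?ltW.
- by move=> u; rewrite mule_ge0// lee_fin.
rewrite (op_cst opI) ?divr_ge0 ?(ltW s0)// (op_scale opI)//.
rewrite (_ : s%:E = (s / 2)%:E + (2 * s)^-1%:E * (s ^+ 2)%:E)%E; last first.
  by rewrite -EFinM -EFinD; congr (_%:E); field; rewrite gt_eqF.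
by rewrite leeD2l// lee_wpmul2l// lee_fin.
Qed.

End indep.

Lemma indep_map J T T' (E : J -> (T -> \bar R) -> \bar R)
    (E' : J -> (T' -> \bar R) -> \bar R) (phi : J -> T -> T') (js : seq J) f :
  (forall j, expectation_op (E' j)) -> (forall s, 0 <= f s)%E ->
  (forall j g, (forall x, 0 <= g x)%E -> E j (g \o phi j) = E' j g) ->
  indep E js (fun s => f [seq phi z.1 z.2 | z <- zip js s]) = indep E' js f.
Proof.
move=> opE' + H; elim: js f => [//|j js IH] f f0 /=.
rewrite -(H j) => [|x]; last by apply: op_ge0 => [|s]; [exact: op_indep|].
by congr (E j); apply/funext => x /=; rewrite -IH.
Qed.

Lemma indep_eq J T (E E' : J -> (T -> \bar R) -> \bar R)
    (js : seq J) f :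
  (forall j, expectation_op (E j)) -> (forall s, 0 <= f s)%E ->
  (forall j g, (forall x, 0 <= g x)%E -> E j g = E' j g) ->
  indep E js f = indep E' js f.
Proof.
move=> opE + H; elim: js f => [//|j js IH] f f0 /=.
rewrite H => [|x]; last by apply: op_ge0 => [|s]; [exact: op_indep|].
by congr (E' j); apply/funext => x /=; rewrite -IH.
Qed.

End operators.

(** * The Poisson law *)
Section poisson.
Context {R : realType}.
Implicit Types (a b v : R) (g : nat -> R).

Definition pois a k : R := expR (- a) * (a ^+ k / k`!%:R).

Definition poisE a (f : nat -> \bar R) : \bar R :=
  (\sum_(k <oo) (pois a k)%:E * f k)%E.

(** [poisE] takes nonnegative functions, but moments are computed from signed
monomials: their means are limits of real series.  A record keeps unification
from unfolding the convergence statement. *)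
Record has_mean a g v : Prop := HasMean {
  has_mean_cvg : series (fun k => pois a k * g k) @ \oo --> v }.

Lemma pois_ge0 a k : 0 <= a -> 0 <= pois a k.
Proof. by move=> a0; rewrite mulr_ge0 ?expR_ge0// divr_ge0// exprn_ge0. Qed.

Lemma has_mean_ext a g g' v v' : has_mean a g v -> g =1 g' -> v = v' ->
  has_mean a g' v'.
Proof. by move=> h /funext <- <-. Qed.

Lemma has_meanD a g g' v v' : has_mean a g v -> has_mean a g' v' ->
  has_mean a (fun k => g k + g' k) (v + v').
Proof.
move=> [h] [h']; split.
rewrite (_ : series _ = (fun n => series (fun k => pois a k * g k) n +
  series (fun k => pois a k * g' k) n)); first exact: cvgD.
apply/funext => n; rewrite /series/= -big_split/=.
by apply: eq_bigr => k _; rewrite mulrDr.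
Qed.

Lemma has_meanZ a c g v : has_mean a g v -> has_mean a (fun k => c * g k) (c * v).
Proof.
move=> [h]; split.
rewrite (_ : series _ = (fun n => c * series (fun k => pois a k * g k) n)).
  by apply: cvgMr.
apply/funext => n; rewrite /series/= mulr_sumr.
by apply: eq_bigr => k _; rewrite mulrCA.
Qed.

Lemma has_mean_exp a c : has_mean a (fun k => c ^+ k) (expR (a * (c - 1))).
Proof.
split.
rewrite (_ : series _ = (fun n => expR (- a) * series (exp_coeff (a * c)) n)).
  rewrite mulrBr mulr1 addrC expRD; apply: cvgMr.
  exact: is_cvg_series_exp_coeff.
apply/funext => n; rewrite /series/= mulr_sumr.
by apply: eq_bigr => k _; rewrite /pois /exp_coeff/= exprMn; ring.
Qed.

(** The identity E[X g(X)] = a E[g(X + 1)] produces all moments by recursion on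
the degree. *)
Lemma has_mean_stein a g v :
  has_mean a (fun k => g k.+1) v -> has_mean a (fun k => k%:R * g k) (a * v).
Proof.
move=> [h]; split; rewrite -cvg_shiftS.
rewrite (_ : (fun n => _) =
  (fun n => a * series (fun k => pois a k * g k.+1) n)); first exact: cvgMr.
apply/funext => n; rewrite /series/= big_nat_recl// mul0r mulr0 add0r mulr_sumr.
apply: eq_bigr => k _; rewrite /pois factS exprS natrM.
have k0 : (k.+1%:R : R) != 0 by rewrite pnatr_eq0.
have f0 : (k`!%:R : R) != 0 by rewrite pnatr_eq0 -lt0n fact_gt0.
by field; rewrite f0 /= addrC natr1 k0.
Qed.

Lemma has_mean1 a : has_mean a (fun=> 1) 1.
Proof.
refine (has_mean_ext (has_mean_exp a 1) _ _); last by rewrite subrr mulr0 expR0.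
by move=> k; rewrite expr1n.
Qed.

Lemma has_mean_id a : has_mean a (fun k => k%:R) a.
Proof.
refine (has_mean_ext (has_mean_stein (g := fun=> 1) (has_mean1 a)) _ _).
  by move=> k; rewrite mulr1.
by rewrite mulr1.
Qed.

Lemma has_mean_sqr a : has_mean a (fun k => k%:R ^+ 2) (a + a ^+ 2).
Proof.
have h : has_mean a (fun k => k.+1%:R) (a + 1).
  refine (has_mean_ext (has_meanD (has_mean_id a) (has_mean1 a)) _ erefl).
  by move=> k; rewrite natr1.
by refine (has_mean_ext (has_mean_stein (g := fun k => k%:R) h) _ _) => [k|]; ring.
Qed.

Lemma has_mean_cube a :
  has_mean a (fun k => k%:R ^+ 3) (a + 3 * a ^+ 2 + a ^+ 3).
Proof.
have h : has_mean a (fun k => k.+1%:R ^+ 2) (1 + 3 * a + a ^+ 2).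
  refine (has_mean_ext (has_meanD (has_mean_sqr a)
    (has_meanD (has_meanZ 2 (has_mean_id a)) (has_mean1 a))) _ _) => [k|].
    by rewrite -natr1; ring.
  by ring.
by refine (has_mean_ext (has_mean_stein (g := fun k => k%:R ^+ 2) h) _ _) => [k|]; ring.
Qed.

Lemma has_mean_four a : has_mean a (fun k => k%:R ^+ 4)
  (a + 7 * a ^+ 2 + 6 * a ^+ 3 + a ^+ 4).
Proof.
have h : has_mean a (fun k => k.+1%:R ^+ 3) (1 + 7 * a + 6 * a ^+ 2 + a ^+ 3).
  refine (has_mean_ext (has_meanD (has_mean_cube a)
    (has_meanD (has_meanZ 3 (has_mean_sqr a))
    (has_meanD (has_meanZ 3 (has_mean_id a)) (has_mean1 a)))) _ _) => [k|].
    by rewrite -natr1; ring.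
  by ring.
by refine (has_mean_ext (has_mean_stein (g := fun k => k%:R ^+ 3) h) _ _) => [k|]; ring.
Qed.

(** Degree four is what the second moment of an increment of a squared count
difference requires. *)
Lemma has_mean_poly a (c0 c1 c2 c3 c4 : R) :
  has_mean a (fun k => c0 + c1 * k%:R + c2 * k%:R ^+ 2 + c3 * k%:R ^+ 3 +
    c4 * k%:R ^+ 4)
  (c0 + c1 * a + c2 * (a + a ^+ 2) + c3 * (a + 3 * a ^+ 2 + a ^+ 3) +
    c4 * (a + 7 * a ^+ 2 + 6 * a ^+ 3 + a ^+ 4)).
Proof.
refine (has_meanD (has_meanD (has_meanD (has_meanD _
  (has_meanZ c1 (has_mean_id a))) (has_meanZ c2 (has_mean_sqr a)))
  (has_meanZ c3 (has_mean_cube a))) (has_meanZ c4 (has_mean_four a))).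
refine (has_mean_ext (has_meanZ c0 (has_mean1 a)) _ _) => [k|]; first by rewrite mulr1.
by rewrite mulr1.
Qed.

Lemma poisE_mean a g v : 0 <= a -> (forall k, 0 <= g k) -> has_mean a g v ->
  poisE a (fun k => (g k)%:E) = v%:E.
Proof.
move=> a0 g0 [h]; rewrite /poisE; apply/cvg_lim => //.
rewrite (_ : (fun n => _) = EFin \o series (fun k => pois a k * g k)).
  by apply: cvg_EFin; [exact: nearW|exact: h].
by apply/funext => n /=; rewrite /series/= -sumEFin.
Qed.

Lemma op_pois a : 0 <= a -> expectation_op (poisE a).
Proof.
move=> a0; have p0 k := pois_ge0 k a0; split.
- move=> f g f0 fg; apply: lee_nneseries => k _; first by rewrite mule_ge0// lee_fin.
  by rewrite lee_wpmul2l// lee_fin.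
- move=> f g f0 g0; rewrite /poisE -nneseriesD; last 2 first.
  + by move=> k _; rewrite mule_ge0// lee_fin.
  + by move=> k _; rewrite mule_ge0// lee_fin.
  by apply: eq_eseriesr => k _; rewrite ge0_muleDr.
- move=> c f c0 f0; rewrite /poisE -nneseriesZl; last first.
    by move=> k _; rewrite mule_ge0// lee_fin.
  by apply: eq_eseriesr => k _; rewrite muleCA.
- exact: poisE_mean (has_mean1 a).
Qed.

Lemma poisE_esum a f : 0 <= a -> (forall k, 0 <= f k)%E ->
  poisE a f = (\esum_(k in [set: nat]) (pois a k)%:E * f k)%E.
Proof.
move=> a0 f0; rewrite /poisE nneseries_esumT// => k.
by rewrite mule_ge0// lee_fin pois_ge0.
Qed.

Lemma pois_convolution a b k :
  \sum_(i < k.+1) pois a i * pois b (k - i)%N = pois (a + b) k.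
Proof.
rewrite /pois opprD expRD (addrC a b) exprDn mulr_suml mulr_sumr.
apply: eq_bigr => i _; have ik : (i <= k)%N by rewrite -ltnS.
have := bin_fact ik => /(congr1 (fun n => n%:R : R)); rewrite !natrM => <-.
have nz n : (n`!%:R : R) != 0 by rewrite pnatr_eq0 -lt0n fact_gt0.
have cz : ('C(k, i)%:R : R) != 0 by rewrite pnatr_eq0 -lt0n bin_gt0.
by rewrite -mulr_natr; field; rewrite !nz cz.
Qed.

Lemma poisE_conv a b f : 0 <= a -> 0 <= b -> (forall k, 0 <= f k)%E ->
  poisE a (fun x => poisE b (fun y => f (x + y)%N)) = poisE (a + b) f.
Proof.
move=> a0 b0 f0; have pa k := pois_ge0 k a0; have pb k := pois_ge0 k b0.
rewrite !poisE_esum ?addr_ge0//; last first.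
  by move=> x; apply: op_ge0 => //; exact: op_pois.
pose F x y : \bar R := ((pois a x * pois b y)%:E * f (x + y)%N)%E.
have F0 x y : (0 <= F x y)%E by rewrite mule_ge0// lee_fin mulr_ge0.
transitivity (\esum_(x in [set: nat]) \esum_(y in [set: nat]) F x y)%E.
  apply: eq_esum => x _; rewrite -nneseries_esumT//.
  rewrite -nneseriesZl//; last by move=> k _; rewrite mule_ge0// lee_fin.
  by apply: eq_eseriesr => y _; rewrite muleA -EFinM.
rewrite esum_esum//.
rewrite (reindex_esum (setT `*`` (fun k => `I_k.+1)) _
  (fun z : nat * nat => (z.2, (z.1 - z.2)%N))); last first.
  split=> [//|[k1 x1] [k2 x2]|[x y] _].
    rewrite !inE/= => -[_ h1] [_ h2] [e1 e2]; move: h1 h2 e2; rewrite /= -e1 => h1 h2 e2.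
    have : ((k1 - x1) + x1 = (k2 - x1) + x1)%N by rewrite e2.
    by rewrite !subnK// => ->.
  exists ((x + y)%N, x) => /=; last by rewrite addKn.
  by split=> //=; rewrite ltnS leq_addr.
rewrite -(esum_esum (a := fun k x => F x (k - x)%N))//.
apply: eq_esum => k _.
rewrite esum_fset//.
rewrite -fsbig_ord -pois_convolution.
rewrite -sumEFin ge0_sume_distrl; last by move=> i _; rewrite lee_fin mulr_ge0.
by apply: eq_bigr => i _; rewrite /F subnKC// -ltnS.
Qed.

Lemma poisE_swap a b (f : nat -> nat -> \bar R) : 0 <= a -> 0 <= b ->
  (forall x y, 0 <= f x y)%E ->
  poisE a (fun x => poisE b (fun y => f x y)) =
  poisE b (fun y => poisE a (fun x => f x y)).
Proof.
move=> a0 b0 f0; have pa k := pois_ge0 k a0; have pb k := pois_ge0 k b0.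
transitivity (\sum_(x <oo) \sum_(y <oo) (pois a x * pois b y)%:E * f x y)%E.
  apply: eq_eseriesr => x _; rewrite /poisE -nneseriesZl; last first.
    by move=> y _; rewrite mule_ge0// lee_fin.
  by apply: eq_eseriesr => y _; rewrite muleA -EFinM.
rewrite nneseries_interchange; last first.
  by move=> x y; rewrite mule_ge0// lee_fin mulr_ge0.
apply: eq_eseriesr => y _; rewrite /poisE -nneseriesZl; last first.
  by move=> x _; rewrite mule_ge0// lee_fin.
by apply: eq_eseriesr => x _; rewrite muleA -EFinM (mulrC (pois b y)).
Qed.

End poisson.

(** * Two independent counts in one cell *)
Section product_operators.
Context {R : realType}.
Implicit Types (a b c h t : R).

Lemma op_const T (E : (T -> \bar R) -> \bar R) (v : \bar R) :
  expectation_op E -> (0 <= v)%E -> E (fun=> v) = v.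
Proof.
move=> opE; case: v => [r|_|//]; first by rewrite lee_fin; exact: op_cst.
apply/eqyP => r r0; rewrite -(op_cst opE (ltW r0)).
by apply: (op_le opE) => x; rewrite ?leey// lee_fin ltW.
Qed.

Definition prodE T U (E : (T -> \bar R) -> \bar R) (F : (U -> \bar R) -> \bar R)
  (f : T * U -> \bar R) : \bar R := E (fun x => F (fun y => f (x, y))).

Lemma op_prod T U (E : (T -> \bar R) -> \bar R) (F : (U -> \bar R) -> \bar R) :
  expectation_op E -> expectation_op F -> expectation_op (prodE E F).
Proof. by move=> opE opF; exact: (op_bind (F := fun=> F) pair opE (fun=> opF)). Qed.

Definition bernE h (f : bool -> \bar R) : \bar R :=
  ((1 - h)%:E * f false + h%:E * f true)%E.

Lemma op_bern h : 0 <= h <= 1 -> expectation_op (bernE h).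
Proof.
move=> /andP[h0 h1]; have h1' : 0 <= 1 - h by rewrite subr_ge0.
split.
- by move=> f g f0 fg; apply: leeD; rewrite lee_wpmul2l// lee_fin.
- by move=> f g f0 g0; rewrite /bernE !ge0_muleDr// addeACA.
- move=> c f c0 f0; rewrite /bernE [RHS]ge0_muleDr; last 2 first.
  + by rewrite mule_ge0// lee_fin.
  + by rewrite mule_ge0// lee_fin.
  by rewrite muleCA (muleCA h%:E).
- by rewrite /bernE !mule1 -EFinD subrK.
Qed.

Definition cellE a b := prodE (@poisE R a) (poisE b).

Lemma op_cell a b : 0 <= a -> 0 <= b -> expectation_op (cellE a b).
Proof. by move=> a0 b0; apply: op_prod; exact: op_pois. Qed.

Lemma poisE_poly a F (c0 c1 c2 c3 c4 : R) : 0 <= a -> (forall k, 0 <= F k)%E ->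
  (forall k, F k = (c0 + c1 * k%:R + c2 * k%:R ^+ 2 + c3 * k%:R ^+ 3 +
    c4 * k%:R ^+ 4)%:E) ->
  poisE a F = (c0 + c1 * a + c2 * (a + a ^+ 2) +
    c3 * (a + 3 * a ^+ 2 + a ^+ 3) +
    c4 * (a + 7 * a ^+ 2 + 6 * a ^+ 3 + a ^+ 4))%:E.
Proof.
move=> a0 F0 FE; rewrite (funext FE); apply: poisE_mean => //.
  by move=> k; rewrite -lee_fin -FE.
exact: has_mean_poly.
Qed.

Lemma cellE_poly a b F (c0 c1 c2 : R) : 0 <= a -> 0 <= b ->
  (forall z, 0 <= F z)%E ->
  (forall z, F z = (c0 + c1 * (z.1%:R - z.2%:R) +
    c2 * (z.1%:R - z.2%:R) ^+ 2)%:E) ->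
  cellE a b F = (c0 + c1 * (a - b) + c2 * (a + b + (a - b) ^+ 2))%:E.
Proof.
move=> a0 b0 F0 FE; rewrite /cellE /prodE.
rewrite (poisE_poly (c0 := c0 - c1 * b + c2 * (b + b ^+ 2))
  (c1 := c1 - 2 * c2 * b) (c2 := c2) (c3 := 0) (c4 := 0) a0); last 2 first.
- by move=> k; apply: op_ge0 => //; exact: op_pois.
- move=> x; rewrite (poisE_poly (c0 := c0 + c1 * x%:R + c2 * x%:R ^+ 2)
    (c1 := - c1 - 2 * c2 * x%:R) (c2 := c2) (c3 := 0) (c4 := 0) b0)//.
    by congr (_%:E); ring.
  by move=> y; rewrite FE/=; congr (_%:E); ring.
by congr (_%:E); ring.
Qed.

End product_operators.

(** * The statistic of independent counts *)
Section chi2_counts.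
Context {R : realType}.
Implicit Types (a b c h t : R).

Definition sqdiff (z : nat * nat) : R := (z.1%:R - z.2%:R) ^+ 2.

Definition power J (E : J -> (nat * nat -> \bar R) -> \bar R) js t : \bar R :=
  indep E js (fun s => (t < \sum_(z <- s) sqdiff z)%R%:R%:E).

(** When two laws of the counts are images of one law on a common space, the
difference of their statistics is a sum of independent terms, and Chebyshev's
inequality bounds the probability that only one of them rejects. *)
Lemma power_couple J T (C : J -> (T -> \bar R) -> \bar R)
    (phi1 phi2 : J -> T -> nat * nat) (E1 E2 : J -> (nat * nat -> \bar R) -> \bar R)
    js (a v : J -> R) (k t1 t2 : R) :
  (forall j, expectation_op (C j)) ->
  (forall j, expectation_op (E1 j)) -> (forall j, expectation_op (E2 j)) ->
  (forall j, 0 <= v j) -> 0 < k ->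
  (forall j g, (forall z, 0 <= g z)%E -> C j (g \o phi1 j) = E1 j g) ->
  (forall j g, (forall z, 0 <= g z)%E -> C j (g \o phi2 j) = E2 j g) ->
  (forall j c, C j (fun x =>
      ((c + (sqdiff (phi1 j x) - sqdiff (phi2 j x))) ^+ 2)%:E) <=
     ((c + a j) ^+ 2 + v j)%:E)%E ->
  \sum_(j <- js) a j + k <= t1 - t2 ->
  (power E1 js t1 <= power E2 js t2 + ((\sum_(j <- js) v j) / k ^+ 2)%:E)%E.
Proof.
move=> opC opE1 opE2 v0 k0 H1 H2 HC at12; have opI := op_indep js opC.
rewrite /power -(indep_map js opE1 _ H1); last by move=> s; rewrite lee_fin.
rewrite -(indep_map js opE2 _ H2); last by move=> s; rewrite lee_fin.
set w := fun j x => sqdiff (phi1 j x) - sqdiff (phi2 j x) in HC.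
apply: le_trans _ (leeD (le_refl _) (indep_chebyshev js opC v0 k0 HC)).
rewrite -(op_add opI); last 2 first.
- by move=> s; rewrite lee_fin.
- by move=> s; rewrite lee_fin.
apply: (op_le opI) => s; first by rewrite lee_fin.
rewrite -EFinD lee_fin !big_map /w sumrB.
set K1 := \sum_(_ <- _) _; set K2 := \sum_(_ <- zip _ _) _; set A := \sum_(_ <- _) _.
have [tK1|] := ltP t1 K1; last by rewrite addr_ge0.
have [tK2|K2t] := ltP t2 K2; first by rewrite lerDl.
rewrite (_ : (k <= _) = true) ?addr_ge0 ?lerDr//.
by apply: le_trans (ler_norm _); move: at12; rewrite -/A; lra.
Qed.

Lemma power_tilt J (E : J -> (nat * nat -> \bar R) -> \bar R)
   (L : J -> nat * nat -> R) (c : J -> R) (s : R) js t :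
  (forall j, expectation_op (E j)) -> (forall j x, 0 <= L j x) -> 0 < s ->
  (forall j, E j (EFin \o L j) = 1%E) ->
  (forall j, E j (fun x => (L j x ^+ 2)%:E) = (c j)%:E) ->
  \prod_(j <- js) c j <= 1 + s ^+ 2 ->
  (power (fun j g => E j (fun x => (L j x)%:E * g x)%E) js t <=
    power E js t + s%:E)%E.
Proof.
move=> opE L0 s0 L1 L2 cs; apply: (indep_tilt_le opE L0 s0 L1 L2 cs
  (A := fun s => (t < \sum_(z <- s) sqdiff z)%R%:R)).
by move=> u; case: (_ < _); rewrite /= ?lexx ?ler01.
Qed.

(** The likelihood ratio of the Poisson law of mean l + a to that of mean l. *)
Definition poisL l a k : R := expR (- a) * (1 + a / l) ^+ k.

Lemma poisE_tilt l a f : 0 < l ->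
  poisE (l + a) f = poisE l (fun k => (poisL l a k)%:E * f k)%E.
Proof.
move=> l0; apply: eq_eseriesr => k _; rewrite muleA -EFinM; congr (_%:E * _)%E.
rewrite /pois /poisL opprD expRD.
rewrite (_ : l + a = l * (1 + a / l)); first by rewrite exprMn; ring.
by field; rewrite gt_eqF.
Qed.

Lemma has_mean_poisL l a : 0 < l -> has_mean l (poisL l a) 1.
Proof.
move=> l0; refine (has_mean_ext (has_meanZ _ (has_mean_exp _ _)) _ _) => //.
have -> : l * (1 + a / l - 1) = a by field; rewrite gt_eqF.
by rewrite -expRD addNr expR0.
Qed.

Lemma has_mean_poisL2 l a : 0 < l ->
  has_mean l (fun k => poisL l a k ^+ 2) (expR (a ^+ 2 / l)).
Proof.
move=> l0; refine (has_mean_ext (has_meanZ (expR (- a) ^+ 2)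
  (has_mean_exp l ((1 + a / l) ^+ 2))) _ _) => [k|].
  by rewrite /poisL exprMn; ring.
rewrite expr2 -!expRD; congr expR; field; rewrite gt_eqF//.
Qed.

Lemma poisL_ge0 l a k : 0 < l -> 0 <= l + a -> 0 <= poisL l a k.
Proof.
move=> l0 la; rewrite mulr_ge0 ?expR_ge0// exprn_ge0//.
by rewrite -(mulfV (lt0r_neq0 l0)) -mulrDl divr_ge0// ltW.
Qed.

End chi2_counts.

Lemma prod_expR (R : realType) J (js : seq J) (f : J -> R) :
  \prod_(j <- js) expR (f j) = expR (\sum_(j <- js) f j).
Proof.
elim: js => [|j js IH]; first by rewrite !big_nil expR0.
by rewrite !big_cons IH expRD.
Qed.

(** * Perturbations of the null law that are close in total variation *)
Section regimes.
Context {R : realType}.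
Implicit Types (a b c h t l : R).

(** The likelihood ratio of a cell has second moment exp (e_j^2 / l), so the
hypothesis bounds the divergence of the alternative from the null. *)
Lemma power_poisson_shift J (js : seq J) l (e : J -> R) (s t : R) :
  0 < l -> (forall j, 0 <= l + e j) -> 0 < s ->
  expR (\sum_(j <- js) e j ^+ 2 / l) <= 1 + s ^+ 2 ->
  (power (fun j => cellE l (l + e j)) js t <=
   power (fun=> cellE l l) js t + s%:E)%E.
Proof.
move=> l0 le0 s0 hs; have l0' := ltW l0.
have opl : expectation_op (@poisE R l) by exact: op_pois.
rewrite -prod_expR in hs.
rewrite (_ : (fun j => _) = (fun j g => cellE l l
   (fun z => (poisL l (e j) z.2)%:E * g z)%E)); last first.
  apply/funext => j; apply/funext => g; congr (poisE l); apply/funext => x.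
  by rewrite poisE_tilt.
apply: (power_tilt _ _ _ s0 _ _ hs).
- by move=> _; exact: op_cell.
- by move=> j x; exact: poisL_ge0.
- move=> j; rewrite /cellE /prodE /comp/=.
  rewrite (poisE_mean l0' _ (has_mean_poisL (e j) l0)).
    by rewrite (op_one opl).
  by move=> k; exact: poisL_ge0.
- move=> j; rewrite /cellE /prodE /comp/=.
  rewrite (poisE_mean l0' _ (has_mean_poisL2 (e j) l0)).
    by rewrite (op_cst opl)// expR_ge0.
  by move=> k; exact: sqr_ge0.
Qed.

(** The null law of a cell, contaminated: with probability h, the first sample
receives a further Poisson (a) number of points. *)
Definition contamE h a l (f : nat * nat -> \bar R) : \bar R :=
  ((1 - h)%:E * cellE l l f + h%:E * cellE (l + a) l f)%E.

Definition contamL h a l (z : nat * nat) : R := 1 - h + h * poisL l a z.1.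

Section contaminated.
Variables (h a l : R).
Hypotheses (h01 : 0 <= h <= 1) (a0 : 0 <= a) (l0 : 0 < l).

Let h0 : 0 <= h. Proof. by case/andP: h01. Qed.
Let h1 : 0 <= 1 - h. Proof. by rewrite subr_ge0; case/andP: h01. Qed.
Let la0 : 0 <= l + a. Proof. by rewrite addr_ge0// ltW. Qed.
Let opl : expectation_op (@poisE R l). Proof. exact/op_pois/ltW. Qed.
Let opa : expectation_op (@poisE R a). Proof. exact/op_pois. Qed.
Let opla : expectation_op (@poisE R (l + a)). Proof. exact/op_pois. Qed.
Let opll : expectation_op (@cellE R l l). Proof. exact: op_prod. Qed.
Let oplal : expectation_op (@cellE R (l + a) l). Proof. exact: op_prod. Qed.

Lemma op_contam : expectation_op (contamE h a l).
Proof.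
split.
- move=> f g f0 fg; apply: leeD; rewrite lee_wpmul2l ?lee_fin//.
    exact: (op_le opll).
  exact: (op_le oplal).
- move=> f g f0 g0; rewrite /contamE (op_add opll)// (op_add oplal)//.
  by rewrite !ge0_muleDr ?op_ge0// addeACA.
- move=> c f c0 f0; rewrite /contamE (op_scale opll)// (op_scale oplal)//.
  by rewrite ge0_muleDr ?mule_ge0 ?op_ge0 ?lee_fin// muleCA (muleCA h%:E).
- by rewrite /contamE (op_one opll) (op_one oplal) !mule1 -EFinD subrK.
Qed.

Lemma contamL_ge0 z : 0 <= contamL h a l z.
Proof. by rewrite addr_ge0// mulr_ge0// poisL_ge0. Qed.

Lemma contam_tilt g : (forall z, 0 <= g z)%E ->
  contamE h a l g = cellE l l (fun z => (contamL h a l z)%:E * g z)%E.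
Proof.
move=> g0; have p0 k := poisL_ge0 k l0 la0.
have G0 x : (0 <= poisE l (fun y => g (x, y)))%E by exact: op_ge0.
rewrite /contamE /cellE /prodE poisE_tilt// -(op_scale opl)//.
rewrite -(op_scale opl)//.
rewrite -(op_add opl); last 2 first.
- by move=> x; rewrite mule_ge0// lee_fin.
- by move=> x; rewrite !mule_ge0// lee_fin.
congr (poisE l); apply/funext => x; rewrite muleA -EFinM -ge0_muleDl; last 2 first.
- by rewrite lee_fin.
- by rewrite lee_fin mulr_ge0.
by rewrite -EFinD -(op_scale opl)//; exact: (contamL_ge0 (x, 0%N)).
by move=> x; rewrite mule_ge0// lee_fin.
Qed.

Lemma contamL_mean1 : cellE l l (EFin \o contamL h a l) = 1%E.
Proof.
rewrite -(op_one op_contam) contam_tilt//.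
by congr cellE; apply/funext => z; rewrite mule1.
Qed.

Lemma contamL_mean2 : cellE l l (fun z => (contamL h a l z ^+ 2)%:E) =
  (1 + h ^+ 2 * (expR (a ^+ 2 / l) - 1))%:E.
Proof.
rewrite /cellE /prodE.
rewrite (_ : (fun x => _) = (fun x => (contamL h a l (x, 0%N) ^+ 2)%:E)); last first.
  apply/funext => x; exact: (op_cst opl (sqr_ge0 (contamL h a l (x, 0%N)))).
apply: poisE_mean (ltW l0) _ _ => [k|]; first exact: sqr_ge0.
refine (has_mean_ext (has_meanD (has_meanZ ((1 - h) ^+ 2) (has_mean1 l))
  (has_meanD (has_meanZ (2 * (1 - h) * h) (has_mean_poisL a l0))
   (has_meanZ (h ^+ 2) (has_mean_poisL2 a l0)))) _ _) => [k|].
  by rewrite /contamL /=; ring.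
by ring.
Qed.

Lemma power_contam J (js : seq J) s t : 0 < s ->
  (1 + h ^+ 2 * (expR (a ^+ 2 / l) - 1)) ^+ size js <= 1 + s ^+ 2 ->
  (power (fun=> contamE h a l) js t <= power (fun=> cellE l l) js t + s%:E)%E.
Proof.
move=> s0 hs.
have -> : power (fun=> contamE h a l) js t =
    power (fun=> fun g => cellE l l (fun z => (contamL h a l z)%:E * g z)%E) js t.
  apply: indep_eq => [_|u|_ g g0]; first exact: op_contam.
    by rewrite lee_fin.
  exact: contam_tilt.
apply: (power_tilt (c := fun=> 1 + h ^+ 2 * (expR (a ^+ 2 / l) - 1)) t _ _ s0).
- by [].
- by move=> j; exact: contamL_ge0.
- by move=> j; exact: contamL_mean1.
- by move=> j; exact: contamL_mean2.
- by rewrite big_const_seq count_predT iter_mulr_1.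
Qed.

(** The two null counts, then the number of extra points and the coin that
decides whether they are added. *)
Definition contamC := prodE (@cellE R l l) (prodE (poisE a) (bernE h)).

Definition contam_phi (z : (nat * nat) * (nat * bool)) : nat * nat :=
  ((z.1.1 + z.2.2 * z.2.1)%N, z.1.2).

Lemma op_contamC : expectation_op contamC.
Proof. by apply: op_prod => //; apply: op_prod => //; exact: op_bern. Qed.

Lemma contamC_null g : (forall z, 0 <= g z)%E ->
  contamC (g \o fst) = cellE l l g.
Proof.
move=> g0; congr (cellE l l); apply/funext => z.
exact: (op_const (op_prod opa (op_bern h01)) (g0 z)).
Qed.

Lemma contamC_contam g : (forall z, 0 <= g z)%E ->
  contamC (g \o contam_phi) = contamE h a l g.
Proof.
move=> g0; have l0' := ltW l0; rewrite /contamE.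
have -> : cellE l l g = poisE l (fun x => poisE l (fun y => g (x, y))) by [].
have E2 : cellE (l + a) l g =
    poisE l (fun x => poisE l (fun y => poisE a (fun k => g ((x + k)%N, y)))).
  have F0 k : (0 <= poisE l (fun y => g (k, y)))%E by exact: op_ge0.
  have -> : cellE (l + a) l g = poisE (l + a) (fun x => poisE l (fun y => g (x, y))).
    by [].
  rewrite -(poisE_conv l0' a0 F0).
  by congr (poisE l); apply/funext => x; exact: poisE_swap.
have G0 x y : (0 <= poisE a (fun k => g ((x + k)%N, y)))%E by exact: op_ge0.
have G1 x : (0 <= poisE l (fun y => g (x, y)))%E by exact: op_ge0.
have G2 x : (0 <= poisE l (fun y => poisE a (fun k => g ((x + k)%N, y))))%E.
  by exact: op_ge0.
rewrite E2 -(op_scale opl)// -(op_scale opl)// -(op_add opl); last 2 first.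
- by move=> x; rewrite mule_ge0.
- by move=> x; rewrite mule_ge0.
congr (poisE l); apply/funext => x.
rewrite -(op_scale opl)// -(op_scale opl)// -(op_add opl); last 2 first.
- by move=> y; rewrite mule_ge0.
- by move=> y; rewrite mule_ge0.
congr (poisE l); apply/funext => y.
rewrite /prodE /bernE /= -(op_scale opa)//.
rewrite (op_add opa); last 2 first.
- by move=> k; rewrite mule_ge0.
- by move=> k; rewrite mule_ge0.
congr (_ + _)%E.
  rewrite (_ : (fun k => _) = fun=> ((1 - h)%:E * g (x, y))%E); last first.
    by apply/funext => k; rewrite /contam_phi /= mul0n addn0.
  by rewrite (op_const opa)// mule_ge0.
by congr (poisE a); apply/funext => k; rewrite /contam_phi /= mul1n.
Qed.

End contaminated.
End regimes.

(** * Increments of the statistic under couplings *)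
Section couplings.
Context {R : realType}.
Implicit Types (a b c h t l : R).

(** Here and in [thinC_sqr], the variance of the increment is bounded by its
second moment. *)
Lemma contamC_sqr h a l c : 0 <= h <= 1 -> 0 <= a -> 0 < l ->
  (contamC h a l (fun z =>
    ((c + (sqdiff z.1 - sqdiff (contam_phi z))) ^+ 2)%:E) <=
  ((c + - (h * (a + a ^+ 2))) ^+ 2 +
   h * (8 * l * (a + a ^+ 2) + (a + 7 * a ^+ 2 + 6 * a ^+ 3 + a ^+ 4)))%:E)%E.
Proof.
move=> h01 a0 l0; have l0' := ltW l0.
rewrite /contamC /prodE (cellE_poly
  (c0 := c ^+ 2 - 2 * h * c * (a + a ^+ 2) +
     h * (a + 7 * a ^+ 2 + 6 * a ^+ 3 + a ^+ 4))
  (c1 := - 4 * h * c * a + 4 * h * (a + 3 * a ^+ 2 + a ^+ 3))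
  (c2 := 4 * h * (a + a ^+ 2)) l0' l0'); last 2 first.
- move=> z; apply: (op_ge0 (op_pois a0)) => k.
  by apply: (op_ge0 (op_bern h01)) => b; rewrite lee_fin sqr_ge0.
- move=> [x y] /=; rewrite (poisE_poly (c0 := c ^+ 2)
    (c1 := - 4 * h * c * (x%:R - y%:R)) (c2 := h * (4 * (x%:R - y%:R) ^+ 2 - 2 * c))
    (c3 := 4 * h * (x%:R - y%:R)) (c4 := h) a0); last 2 first.
  + move=> k; apply: (op_ge0 (op_bern h01)) => b.
    by rewrite lee_fin sqr_ge0.
  + move=> k; rewrite /bernE /sqdiff /contam_phi /= -!EFinM -EFinD mul0n mul1n.
    by congr (_%:E); rewrite addn0 natrD; ring.
  by congr (_%:E); ring.
rewrite lee_fin -subr_ge0.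
rewrite (_ : _ - _ = (h * (a + a ^+ 2)) ^+ 2); first exact: sqr_ge0.
by ring.
Qed.

Section thinning.
Variables (l e : R).
Hypotheses (l0 : 0 < l) (le0 : 0 <= l + e).

(** The second counts under the null and under the alternative share a
Poisson (min (l, l + e)) number of points; the other |e| points on average go to
the law with the larger mean. *)
Definition thinC (l e : R) : (nat * nat * nat -> \bar R) -> \bar R :=
  prodE (cellE l (Num.min l (l + e))) (poisE `|e|).

Definition thin_alt (z : nat * nat * nat) : nat * nat :=
  (z.1.1, z.1.2 + (0 <= e)%R * z.2)%N.

Definition thin_null (z : nat * nat * nat) : nat * nat :=
  (z.1.1, z.1.2 + (e < 0)%R * z.2)%N.

Let l0' : 0 <= l := ltW l0.
Let m0 : 0 <= Num.min l (l + e). Proof. by rewrite le_min l0' le0. Qed.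
Let opl : expectation_op (@poisE R l). Proof. exact: op_pois. Qed.
Let opm : expectation_op (@poisE R (Num.min l (l + e))). Proof. exact: op_pois. Qed.
Let ope : expectation_op (@poisE R `|e|). Proof. exact: op_pois. Qed.

Lemma op_thinC : expectation_op (thinC l e).
Proof. by apply: op_prod => //; exact: op_prod. Qed.

Lemma thin_split g (b : bool) (x : nat) : (forall z, 0 <= g z)%E ->
  poisE (Num.min l (l + e)) (fun y => poisE `|e| (fun k => g (x, y + b * k)%N)) =
  poisE (Num.min l (l + e) + b%:R * `|e|) (fun y => g (x, y)).
Proof.
move=> g0; case: b.
  rewrite mul1r -(poisE_conv m0 (normr_ge0 e) (f := fun y => g (x, y)))//.
  congr (poisE _); apply/funext => y; congr (poisE _); apply/funext => k.
  by rewrite mul1n.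
rewrite mul0r addr0; congr (poisE _); apply/funext => y.
transitivity (poisE `|e| (fun=> g (x, y))); last exact: (op_const ope (g0 (x, y))).
by congr (poisE _); apply/funext => k; rewrite mul0n addn0.
Qed.

Lemma thinC_alt g : (forall z, 0 <= g z)%E ->
  thinC l e (g \o thin_alt) = cellE l (l + e) g.
Proof.
move=> g0; congr (poisE l); apply/funext => x.
rewrite [LHS](@thin_split g (0 <= e)%R x g0).
suff -> : Num.min l (l + e) + (0 <= e)%R%:R * `|e| = l + e by [].
case: (leP 0 e) => e0; rewrite ?mul1r ?mul0r ?addr0.
  by rewrite min_l ?lerDl// ger0_norm.
by rewrite min_r// gerDl ltW.
Qed.

Lemma thinC_null g : (forall z, 0 <= g z)%E ->
  thinC l e (g \o thin_null) = cellE l l g.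
Proof.
move=> g0; congr (poisE l); apply/funext => x.
rewrite [LHS](@thin_split g (e < 0)%R x g0).
suff -> : Num.min l (l + e) + (e < 0)%R%:R * `|e| = l by [].
case: (leP 0 e) => e0; rewrite ?mul1r ?mul0r ?addr0.
  by rewrite min_l ?lerDl.
by rewrite min_r ?gerDl ?ltW// ltr0_norm// addrK.
Qed.

Lemma thinC_sqr c :
  (thinC l e (fun z => ((c + (sqdiff (thin_alt z) - sqdiff (thin_null z))) ^+ 2)%:E)
   <= ((c + (e + e ^+ 2)) ^+ 2 +
       (`|e| + 12 * e ^+ 2 + 10 * e ^+ 4 + 8 * l * `|e| + 8 * l * e ^+ 2))%:E)%E.
Proof.
pose f := `|e|; have f0 : 0 <= f by exact: normr_ge0.
(* With D the difference of the shared counts and k the remaining points, the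
   increment is s (k^2 - 2 D k). *)
pose s : R := if 0 <= e then 1 else -1.
have s2 : s ^+ 2 = 1 by rewrite /s; case: ifP => _; ring.
rewrite /thinC /prodE (cellE_poly
  (c0 := c ^+ 2 + 2 * c * s * (f + f ^+ 2) + (f + 7 * f ^+ 2 + 6 * f ^+ 3 + f ^+ 4))
  (c1 := - 4 * c * s * f - 4 * (f + 3 * f ^+ 2 + f ^+ 3))
  (c2 := 4 * (f + f ^+ 2)) l0' m0); last 2 first.
- by move=> z; apply: op_ge0 => // k; rewrite lee_fin sqr_ge0.
- move=> [x y] /=; rewrite -/f (poisE_poly (c0 := c ^+ 2)
    (c1 := - 4 * c * s * (x%:R - y%:R)) (c2 := 4 * (x%:R - y%:R) ^+ 2 + 2 * c * s)
    (c3 := - 4 * (x%:R - y%:R)) (c4 := 1) f0); last 2 first.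
  + by move=> k; rewrite lee_fin sqr_ge0.
  + move=> k; rewrite /sqdiff /thin_alt /thin_null /s /=; congr (_%:E).
    by case: (leP 0 e) => _; rewrite ?mul0n ?mul1n ?addn0 ?natrD; ring.
  by congr (_%:E); ring.
rewrite lee_fin /s.
have [e0|e0] := leP 0 e.
  rewrite min_l ?lerDl// /f ger0_norm//.
  have e3 : 0 <= e ^+ 3 by rewrite exprn_ge0.
  have e4 : 0 <= e ^+ 4 by rewrite exprn_ge0.
  have h : 0 <= (e - e ^+ 2) ^+ 2 by exact: sqr_ge0.
  have E4 : (e - e ^+ 2) ^+ 2 = e ^+ 2 - 2 * e ^+ 3 + e ^+ 4 by ring.
  nra.
rewrite min_r ?gerDl ?ltW// /f ltr0_norm//.
pose g := - e; have g0 : 0 < g by rewrite oppr_gt0.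
rewrite (_ : e = - g); last by rewrite opprK.
rewrite opprK.
have e3 : 0 <= g ^+ 3 by rewrite exprn_ge0 ?ltW.
have e4 : 0 <= g ^+ 4 by rewrite exprn_ge0 ?ltW.
have h : 0 <= (g - g ^+ 2) ^+ 2 by exact: sqr_ge0.
have E4 : (g - g ^+ 2) ^+ 2 = g ^+ 2 - 2 * g ^+ 3 + g ^+ 4 by ring.
nra.
Qed.

End thinning.
End couplings.

(** * Independent counts: the power is at most twice the level *)
Section counts.
Context {R : realType}.
Implicit Types (l t : R).

Lemma expR_le1D2x (x : R) : 0 <= x <= 2^-1 -> expR x <= 1 + 2 * x.
Proof.
move=> /andP[x0 x1].
have h : 1 - x <= expR (- x) by have := expR_ge1Dx (- x).
have p : 0 < 1 - x by lra.
have : expR x <= (1 - x)^-1.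
  by rewrite -[expR x]invrK -expRN lef_pV2 ?posrE ?expR_gt0.
move/le_trans; apply; rewrite -div1r ler_pdivrMr//; nra.
Qed.

Lemma sum_sqr_le (J : Type) (js : seq J) (x : J -> R) : (forall j, 0 <= x j) ->
  \sum_(j <- js) x j ^+ 2 <= (\sum_(j <- js) x j) ^+ 2.
Proof.
move=> x0; elim: js => [|j js IH]; first by rewrite !big_nil expr0n.
rewrite !big_cons; have := x0 j.
have : 0 <= \sum_(j <- js) x j by rewrite sumr_ge0.
move: IH; set S := \sum_(j <- js) x j => IH S0 xj.
by rewrite sqrrD -addrA lerD2l (le_trans IH)// lerDr mulrn_wge0// mulr_ge0.
Qed.

(** Smoothness of the null law at the scale of its standard deviation, with
u = sqrt l.  Extra points in number Poisson (u) make the divergence per cell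
h^2 (exp 1 - 1), whatever l is, while the statistic gains h (u + u^2) per cell on
average.  With h = delta / sqrt m, the total gain is delta (sqrt n + sqrt (n l)),
comparable with the standard deviation both for sparse and for crowded cells. *)
Lemma null_power_smooth (alpha delta u : R) (J : Type) (js : seq J) t :
  0 < alpha < 1 -> 0 < delta <= 1 -> 0 < u -> (0 < size js)%N ->
  delta ^+ 2 * (expR 1 - 1) <= alpha ^+ 2 / 64 ->
  288 <= delta * alpha * Num.sqrt (size js)%:R ->
  288 <= delta * alpha * Num.sqrt (size js)%:R * u ->
  (power (fun=> cellE (u ^+ 2) (u ^+ 2)) js
     (t - delta * Num.sqrt (size js)%:R * (u + u ^+ 2) / 2) <=
   power (fun=> cellE (u ^+ 2) (u ^+ 2)) js t + (alpha / 2)%:E)%E.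
Proof.
move=> /andP[a0 a1] /andP[d0 d1] u0 m0 He H1 H2.
set sm := Num.sqrt _ in H1 H2 *.
have m1 : 1 <= (size js)%:R :> R by rewrite ler1n.
have sm2 : sm ^+ 2 = (size js)%:R by rewrite sqr_sqrtr.
have sm1 : 1 <= sm by rewrite -[1]sqrtr1 ler_sqrt// (lt_le_trans _ m1).
have sm0 : 0 < sm by exact: lt_le_trans sm1.
have l0 : 0 < u ^+ 2 by rewrite exprn_gt0.
have u0' := ltW u0.
pose h := delta / sm.
have h01 : 0 <= h <= 1.
  rewrite /h divr_ge0 ?(ltW d0) ?(ltW sm0)//= ler_pdivrMr// mul1r.
  exact: le_trans d1 sm1.
pose A := delta * sm * (u + u ^+ 2).
have A0 : 0 < A by rewrite !mulr_gt0// addr_gt0.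
have hsm : (size js)%:R * h = delta * sm.
  by rewrite -sm2 /h; field; rewrite gt_eqF.
pose V := h * (8 * u ^+ 2 * (u + u ^+ 2) + (u + 7 * u ^+ 2 + 6 * u ^+ 3 + u ^+ 4)).
have V0 : 0 <= V.
  rewrite mulr_ge0//; first by case/andP: h01.
  by rewrite !addr_ge0 ?mulr_ge0 ?addr_ge0 ?exprn_ge0.
have sumc x : \sum_(j <- js) x = (size js)%:R * x.
  by rewrite big_const_seq count_predT iter_addr_0 mulr_natl.
(* Closeness of the contaminated law to the null, by the divergence bound. *)
have step1 : (power (fun=> contamE h u (u ^+ 2)) js t <=
    power (fun=> cellE (u ^+ 2) (u ^+ 2)) js t + (alpha / 4)%:E)%E.
  apply: power_contam => //; first by rewrite divr_gt0.
  rewrite divff ?gt_eqF//.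
  apply: (@le_trans _ _ (expR (delta ^+ 2 * (expR 1 - 1)))).
    rewrite (_ : delta ^+ 2 * _ = h ^+ 2 * (expR 1 - 1) * (size js)%:R); last first.
      by rewrite -sm2 /h; field; rewrite gt_eqF.
    rewrite expRM_natr lerXn2r ?nnegrE ?expR_ge0 ?expR_ge1Dx//.
    by rewrite addr_ge0// mulr_ge0 ?sqr_ge0// subr_ge0 -[leLHS]expR0 ler_expR.
  have e1 : 0 <= delta ^+ 2 * (expR 1 - 1).
    by rewrite mulr_ge0 ?sqr_ge0// subr_ge0 -[leLHS]expR0 ler_expR.
  have a2 : alpha ^+ 2 <= 1 by rewrite expr_le1// ltW.
  apply: le_trans (expR_le1D2x _) _; first by rewrite e1/=; lra.
  by rewrite exprMn; lra.
(* The contaminated statistic has mean gain A, and a gain below A / 2 is a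
   deviation of at least A / 2. *)
have step2 : (power (fun=> cellE (u ^+ 2) (u ^+ 2)) js (t - A / 2) <=
    power (fun=> contamE h u (u ^+ 2)) js t +
      ((\sum_(j <- js) V) / (A / 2) ^+ 2)%:E)%E.
  apply: (power_couple (C := fun=> contamC h u (u ^+ 2)) (phi1 := fun=> fst)
    (phi2 := fun=> contam_phi) (a := fun=> - (h * (u + u ^+ 2)))).
  - by move=> _; exact: op_contamC.
  - by move=> _; apply: op_cell; exact: ltW.
  - by move=> _; exact: op_contam.
  - by [].
  - by rewrite divr_gt0.
  - by move=> _ g g0; exact: contamC_null.
  - by move=> _ g g0; exact: contamC_contam.
  - by move=> _ c; exact: contamC_sqr.
  - rewrite sumc mulrN mulrA hsm -/A.
    by lra.
apply: le_trans step2 _.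
apply: le_trans (leeD step1 (le_refl _)) _.
rewrite -addeA leeD2l// -EFinD lee_fin.
rewrite sumc /V mulrA hsm.
suff : delta * sm * (8 * u ^+ 2 * (u + u ^+ 2) +
    (u + 7 * u ^+ 2 + 6 * u ^+ 3 + u ^+ 4)) / (A / 2) ^+ 2 <= alpha / 4 by lra.
rewrite ler_pdivrMr ?exprn_gt0 ?divr_gt0// /A.
(* The variance polynomial is at most 9 u (1 + u)^3, so the bound reduces to
   36 (1 + u) <= (alpha / 4) delta sm u; there sm u = sqrt n and sm = sqrt m
   are both large. *)
have H3 : 36 * (1 + u) <= alpha / 4 * delta * sm * u.
  have : 288 * u <= delta * alpha * sm * u by rewrite ler_wpM2r.
  by lra.
have P0 : 0 <= delta * sm * (u * (1 + u) ^+ 2) / 4.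
  by apply: ltW; rewrite divr_gt0// !mulr_gt0// addr_gt0.
have := ler_wpM2l P0 H3.
rewrite (_ : _ * (36 * _) = delta * sm * (9 * u + 27 * u ^+ 2 + 27 * u ^+ 3 + 9 * u ^+ 4)); last by field.
rewrite (_ : _ / 4 * _ = alpha / 4 * (delta * sm * (u + u ^+ 2) / 2) ^+ 2); last by field.
apply: le_trans; apply: ler_wpM2l; first by rewrite mulr_ge0 ?ltW.
have u2 : 0 <= u ^+ 2 by rewrite exprn_ge0.
have u3 : 0 <= u ^+ 3 by rewrite exprn_ge0.
have u4 : 0 <= u ^+ 4 by rewrite exprn_ge0.
have -> : 8 * u ^+ 2 * (u + u ^+ 2) = 8 * u ^+ 3 + 8 * u ^+ 4 by ring.
by lra.
Qed.

(** The statistic grows by sum e_j^2 on average, since the linear terms sum to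
zero, and the variance of the growth is at most
30 kappa (sqrt n + sqrt (n l))^2. *)
Lemma alternative_power_shift (delta kappa u : R) (J : Type) (js : seq J) (e : J -> R) t :
  0 < delta -> 0 < kappa <= 1 -> 4 * kappa <= delta -> 0 < u -> (0 < size js)%N ->
  (forall j, 0 <= u ^+ 2 + e j) -> \sum_(j <- js) e j = 0 ->
  \sum_(j <- js) `|e j| <= kappa * (u ^+ 2 * (size js)%:R) ->
  \sum_(j <- js) e j ^+ 2 <= kappa * (u ^+ 2 * Num.sqrt (size js)%:R) ->
  (power (fun j => cellE (u ^+ 2) (u ^+ 2 + e j)) js t <=
   power (fun=> cellE (u ^+ 2) (u ^+ 2)) js
     (t - delta * Num.sqrt (size js)%:R * (u + u ^+ 2) / 2) +
   (480 * kappa / delta ^+ 2)%:E)%E.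
Proof.
move=> d0 /andP[k0 k1] kd u0 m0 le0 se sae se2.
set sm := Num.sqrt _ in se2 *.
have m1 : 1 <= (size js)%:R :> R by rewrite ler1n.
have sm2 : sm ^+ 2 = (size js)%:R by rewrite sqr_sqrtr.
have sm1 : 1 <= sm by rewrite -[1]sqrtr1 ler_sqrt// (lt_le_trans _ m1).
have sm0 : 0 < sm by exact: lt_le_trans sm1.
have l0 : 0 < u ^+ 2 by rewrite exprn_gt0.
have u0' := ltW u0.
pose A := delta * sm * (u + u ^+ 2).
have A0 : 0 < A by rewrite !mulr_gt0// addr_gt0.
pose v j := `|e j| + 12 * e j ^+ 2 + 10 * e j ^+ 4 + 8 * u ^+ 2 * `|e j| +
  8 * u ^+ 2 * e j ^+ 2.
have v0 j : 0 <= v j.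
  have e4 : 0 <= e j ^+ 4 by rewrite (exprM (e j) 2 2) sqr_ge0.
  have n0 := normr_ge0 (e j); have s0 := sqr_ge0 (e j).
  have := mulr_ge0 (ltW l0) n0; have := mulr_ge0 (ltW l0) s0.
  by rewrite /v; lra.
have := power_couple (C := fun j => thinC (u ^+ 2) (e j))
  (phi1 := fun j => thin_alt (e j)) (phi2 := fun j => thin_null (e j))
  (E1 := fun j => cellE (u ^+ 2) (u ^+ 2 + e j))
  (E2 := fun=> cellE (u ^+ 2) (u ^+ 2)) (js := js)
  (a := fun j => e j + e j ^+ 2) (v := v) (k := A / 4) (t1 := t) (t2 := t - A / 2).
move=> /(_ _ _ _ v0) main; apply: le_trans (main _ _ _ _ _ _ _ _) _.
- by move=> j; exact: op_thinC.
- by move=> j; apply: op_cell => //; exact: ltW.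
- by move=> j; apply: op_cell; exact: ltW.
- by rewrite divr_gt0.
- by move=> j g g0; exact: thinC_alt.
- by move=> j g g0; exact: thinC_null.
- by move=> j c; exact: thinC_sqr.
- rewrite big_split/= se add0r.
  suff : kappa * (u ^+ 2 * sm) <= A / 4 by lra.
  rewrite /A.
  have : 4 * kappa * (sm * u ^+ 2) <= delta * (sm * u ^+ 2).
    by rewrite ler_wpM2r// mulr_ge0 ?ltW.
  have : 0 <= delta * sm * u by rewrite !mulr_ge0 ?ltW.
  by lra.
rewrite leeD2l// lee_fin ler_pdivrMr ?exprn_gt0 ?divr_gt0//.
have -> : 480 * kappa / delta ^+ 2 * (A / 4) ^+ 2 =
   30 * kappa * (sm ^+ 2 * (u + u ^+ 2) ^+ 2).
  by rewrite /A; field; rewrite gt_eqF.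
rewrite /v !big_split/= -!mulr_sumr.
set S1 := \sum_(j <- js) `|e j| in sae *; set S2 := \sum_(j <- js) e j ^+ 2 in se2 *.
have S4 : \sum_(j <- js) e j ^+ 4 <= S2 ^+ 2.
  under eq_bigr do rewrite (exprM (e _) 2 2).
  by apply: sum_sqr_le => j; exact: sqr_ge0.
have S20 : 0 <= S2 by rewrite sumr_ge0// => j _; exact: sqr_ge0.
have kq : kappa ^+ 2 <= kappa by rewrite expr2 ger_pMl.
have q : S2 ^+ 2 <= kappa * (u ^+ 4 * sm ^+ 2).
  apply: (@le_trans _ _ ((kappa * (u ^+ 2 * sm)) ^+ 2)).
    by rewrite lerXn2r ?nnegrE// !mulr_ge0 ?(ltW k0) ?(ltW l0) ?(ltW sm0).
  rewrite (_ : _ ^+ 2 = kappa ^+ 2 * (u ^+ 4 * sm ^+ 2)); last by ring.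
  by rewrite ler_wpM2r// mulr_ge0 ?sqr_ge0// exprn_ge0.
have sms : sm <= sm ^+ 2 by rewrite expr2 ler_peMl// ltW.
have S2b : S2 <= kappa * (u ^+ 2 * sm ^+ 2).
  by apply: le_trans se2 _; rewrite ler_wpM2l ?(ltW k0)// ler_wpM2l// ltW.
rewrite -sm2 in sae.
have uS1 : u ^+ 2 * S1 <= u ^+ 2 * (kappa * (u ^+ 2 * sm ^+ 2)).
  exact: ler_wpM2l (ltW l0) _ _ sae.
have uS2 : u ^+ 2 * S2 <= u ^+ 2 * (kappa * (u ^+ 2 * sm ^+ 2)).
  exact: ler_wpM2l (ltW l0) _ _ S2b.
have T1 : 0 <= kappa * (u ^+ 2 * sm ^+ 2) by apply: ltW; rewrite !mulr_gt0 ?exprn_gt0.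
have T2 : 0 <= kappa * (u ^+ 3 * sm ^+ 2) by apply: ltW; rewrite !mulr_gt0 ?exprn_gt0.
have T3 : 0 <= kappa * (u ^+ 4 * sm ^+ 2) by apply: ltW; rewrite !mulr_gt0 ?exprn_gt0.
have -> : 30 * kappa * (sm ^+ 2 * (u + u ^+ 2) ^+ 2) =
  30 * (kappa * (u ^+ 2 * sm ^+ 2)) + 60 * (kappa * (u ^+ 3 * sm ^+ 2)) +
  30 * (kappa * (u ^+ 4 * sm ^+ 2)) by ring.
have E1 : u ^+ 2 * (kappa * (u ^+ 2 * sm ^+ 2)) = kappa * (u ^+ 4 * sm ^+ 2) by ring.
by lra.
Qed.

(** The threshold B on sqrt m separates the two regimes: below it the
alternative is close to the null in total variation, above it Chebyshev's
inequality is effective. *)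
Lemma counts_power_le (alpha : R) : 0 < alpha < 1 -> exists kappa N : R,
  [/\ 0 < kappa, kappa <= 1, 0 < N &
  forall (J : Type) (js : seq J) (l : R) (e : J -> R) (t : R),
  0 < l -> (0 < size js)%N -> N <= l * (size js)%:R ->
  (forall j, 0 <= l + e j) -> \sum_(j <- js) e j = 0 ->
  \sum_(j <- js) `|e j| <= kappa * (l * (size js)%:R) ->
  \sum_(j <- js) e j ^+ 2 <= kappa * (l * Num.sqrt (size js)%:R) ->
  (power (fun=> cellE l l) js t <= alpha%:E)%E ->
  (power (fun j => cellE l (l + e j)) js t <= (2 * alpha)%:E)%E].
Proof.
move=> a01; have /andP[a0 a1] := a01.
have E2 : 2 <= expR 1 :> R by apply: le_trans (expR_ge1Dx 1); lra.
have E0 : 0 < expR 1 :> R by exact: expR_gt0.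
(* With delta^2 (exp 1 - 1) <= (alpha / 4)^2 / 4, the contaminated law is within
   alpha / 4 of the null; B makes the Chebyshev bound for its gain at most
   alpha / 4 as well; kappa satisfies 480 kappa / delta^2 <= alpha / 2,
   4 kappa <= delta and kappa B <= alpha^2 / 2. *)
pose delta := alpha / (8 * expR 1).
have d0 : 0 < delta by rewrite divr_gt0// mulr_gt0.
have d1 : delta <= 1 by rewrite ler_pdivrMr ?mulr_gt0// mul1r; lra.
have He : delta ^+ 2 * (expR 1 - 1) <= alpha ^+ 2 / 64.
  rewrite (_ : _ * _ = alpha ^+ 2 / 64 * ((expR 1 - 1) / expR 1 ^+ 2)); last first.
    by rewrite /delta; field; rewrite gt_eqF.
  rewrite ler_piMr ?divr_ge0 ?sqr_ge0// ler_pdivrMr ?exprn_gt0// mul1r; nra.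
pose B := 288 / (delta * alpha).
have B0 : 0 < B by rewrite divr_gt0// mulr_gt0.
pose kappa := alpha ^+ 3 * delta ^+ 2 / 960.
have k0 : 0 < kappa by rewrite divr_gt0 ?mulr_gt0 ?exprn_gt0 ?ltr0n.
have a31 : alpha ^+ 3 <= alpha by rewrite exprS ler_piMr ?(ltW a0)// expr_le1// ltW.
have a30 : 0 < alpha ^+ 3 by rewrite exprn_gt0.
have d20 : 0 < delta ^+ 2 by rewrite exprn_gt0.
have d2d : delta ^+ 2 <= delta by rewrite expr2 ler_piMr// ltW.
have kd2 : 960 * kappa <= alpha * delta ^+ 2.
  by rewrite /kappa mulrC divfK ?pnatr_eq0// ler_wpM2r// ltW.
have kd : 960 * kappa <= delta.
  apply: le_trans kd2 _; apply: le_trans d2d.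
  by rewrite ler_piMl// ltW.
exists kappa, (B ^+ 2); split => //; first lra.
  by rewrite exprn_gt0.
move=> J js l e t l0 m0 nB le0 se sae se2 size_ok.
set m := (size js)%:R in nB sae se2 *; set sm := Num.sqrt m in se2 *.
have m1 : 1 <= m by rewrite ler1n.
have sm2 : sm ^+ 2 = m by rewrite sqr_sqrtr// ltW// (lt_le_trans _ m1).
have sm0 : 0 < sm by rewrite sqrtr_gt0 (lt_le_trans _ m1).
(* Few cells: the two rejection probabilities differ by at most alpha. *)
have [smB|Bsm] := ltP sm B.
  have -> : (2 * alpha)%:E = (alpha%:E + alpha%:E)%E.
    by rewrite -EFinD; congr (_%:E); ring.
  apply: le_trans (leeD size_ok (le_refl _)).
  apply: power_poisson_shift => //.
  rewrite -mulr_suml.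
  have x0 : 0 <= (\sum_(j <- js) e j ^+ 2) / l.
    by rewrite divr_ge0 ?(ltW l0)// sumr_ge0// => j _; exact: sqr_ge0.
  have x1 : (\sum_(j <- js) e j ^+ 2) / l <= kappa * B.
    rewrite ler_pdivrMr//; apply: le_trans se2 _.
    rewrite (mulrC l) mulrA ler_wpM2r ?(ltW l0)// ler_wpM2l ?(ltW k0)//.
    exact: ltW.
  have kB : kappa * B <= alpha ^+ 2 / 2.
    rewrite (_ : kappa * B = alpha ^+ 2 * delta * (3 / 10)); last first.
      by rewrite /kappa /B; field; rewrite !gt_eqF.
    have : 0 <= alpha ^+ 2 by exact: sqr_ge0.
    nra.
  have a21 : alpha ^+ 2 <= 1 by rewrite expr_le1// ltW.
  apply: le_trans (expR_le1D2x _) _; first by rewrite x0/=; lra.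
  lra.
pose u := Num.sqrt l.
have u2 : u ^+ 2 = l by rewrite sqr_sqrtr// ltW.
have u0 : 0 < u by rewrite sqrtr_gt0.
have smu : B <= sm * u.
  by rewrite -(@ler_pXn2r _ 2) ?nnegrE ?(ltW B0) ?(mulr_ge0 (ltW sm0) (ltW u0))// [(sm * u) ^+ 2]exprMn sm2 u2 mulrC.
have BE : delta * alpha * B = 288 by rewrite /B mulrC divfK// gt_eqF// mulr_gt0.
have da0 : 0 <= delta * alpha by rewrite mulr_ge0 ?ltW.
rewrite -u2 in le0 sae se2 size_ok *.
apply: le_trans (alternative_power_shift (delta := delta) (kappa := kappa) t _ _ _ u0 m0 le0 se sae se2) _ => //.
- by rewrite k0/=; lra.
- by lra.
apply: (@le_trans _ _ (alpha%:E + (alpha / 2)%:E + (alpha / 2)%:E)%E); last first.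
  by rewrite -!EFinD lee_fin; lra.
apply: leeD; last first.
  rewrite lee_fin ler_pdivrMr//; lra.
apply: le_trans (leeD size_ok (le_refl _)).
apply: (null_power_smooth t a01 _ u0 m0 He).
- by rewrite d0.
- by rewrite -BE ler_wpM2l.
- by rewrite -mulrA -BE ler_wpM2l.
Qed.

End counts.

(** * Poissonization *)
Section esum_lemmas.
Context {R : realType}.

Lemma esumZl (T : choiceType) (A : set T) (c : R) (f : T -> \bar R) :
  0 <= c -> (forall x, 0 <= f x)%E ->
  (\esum_(x in A) (c%:E * f x) = c%:E * \esum_(x in A) f x)%E.
Proof.
move=> c0 f0.
have le (k : R) (g : T -> \bar R) : 0 <= k -> (forall x, 0 <= g x)%E ->
    (\esum_(x in A) (k%:E * g x) <= k%:E * \esum_(x in A) g x)%E.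
  move=> k0 g0; apply: ge_ereal_sup => _ [X XA] <-.
  have [finX _] := XA.
  rewrite fsbig_finite//= -ge0_sume_distrr//.
  rewrite lee_wpmul2l ?lee_fin//.
  apply: ereal_sup_ubound => /=; exists X => //.
  by rewrite fsbig_finite.
have [->|cn0] := eqVneq c 0.
  by rewrite mul0e; apply: esum1 => x _; rewrite mul0e.
have cp : 0 < c by rewrite lt_neqAle eq_sym cn0.
apply/eqP; rewrite eq_le le//=.
have := le c^-1 (fun x => c%:E * f x)%E.
rewrite invr_ge0 => /(_ c0 _) h.
have {h} : (\esum_(x in A) f x <= c^-1%:E * \esum_(x in A) (c%:E * f x))%E.
  apply: le_trans (h _) => [|x]; last by rewrite mule_ge0// lee_fin.
  rewrite le_eqVlt; apply/orP; left; apply/eqP; apply: eq_esum => x _.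
  by rewrite muleA -EFinM mulVf// mul1e.
move=> h; have := @lee_wpmul2l _ c%:E _ _ _ h.
by rewrite lee_fin muleA -EFinM divff// mul1e; apply.
Qed.

Lemma esum_swap (T U : choiceType) (f : T -> U -> \bar R) :
  (forall x y, 0 <= f x y)%E ->
  (\esum_(x in [set: T]) \esum_(y in [set: U]) f x y =
   \esum_(y in [set: U]) \esum_(x in [set: T]) f x y)%E.
Proof.
move=> f0; rewrite esum_esum// esum_esum//.
rewrite (reindex_esum (setT `*`` (fun _ : U => [set: T])) _
  (fun z => (z.2, z.1)))//; split => [//|[a b] [c d] _ _ /= [-> ->]//|[a b] _].
by exists (b, a).
Qed.

End esum_lemmas.

Section poissonization.
Context d (T : measurableType d) (R : realType) (J : finType) (C : J -> set T).
Hypotheses (mC : forall j, measurable (C j)) (tC : trivIset [set: J] C).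

Definition counts (s : seq T) : {ffun J -> nat} :=
  [ffun j => count (mem (C j)) s].

Definition add_point (j : J) (x : {ffun J -> nat}) : {ffun J -> nat} :=
  [ffun i => (i == j) + x i]%N.

(** Integrands depend on the sample through its counts, which take countably
many values; so it is enough that every value has a measurable fiber. *)
Lemma measurable_comp_countable d' (S : measurableType d') (A : countType)
    (phi : S -> A) (g : A -> \bar R) :
  (forall a, measurable (phi @^-1` [set a])) ->
  measurable_fun setT (g \o phi).
Proof.
move=> mphi _ Y mY; rewrite setTI.
rewrite (_ : _ @^-1` _ = \bigcup_(n in [set: nat])
   (if @unpickle A n is Some a then
      if `[< Y (g a) >] then phi @^-1` [set a] else set0 else set0)).
  apply: bigcup_measurable => n _; case: unpickle => // a.
  by case: ifP.
apply/seteqP; split=> [s /= Ys|s [n _] /=].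
  exists (pickle (phi s)) => //; rewrite pickleK; case: asboolP => //.
by case: unpickle => // a; case: asboolP => //= Ya ->.
Qed.

Lemma counts_fiber k (x : {ffun J -> nat}) :
  measurable [set s : k.-tuple T | counts s = x].
Proof.
rewrite (_ : [set s | _] = \big[setI/setT]_(j : J)
   [set s : k.-tuple T | count (mem (C j)) s = x j]).
  apply: bigsetI_measurable => j _.
  pose f (s : k.-tuple T) : R := \sum_(i < k) \1_(C j) (tnth s i).
  rewrite (_ : [set s | _] = f @^-1` [set (x j)%:R]).
    rewrite -[X in measurable X]setTI.
    have mf : measurable_fun setT f.
      apply: measurable_sum => i; apply: measurableT_comp.
        exact: measurable_indic.
      exact: measurable_tnth.
    by apply: mf => //; exact: measurable_set1.
  have fE s : f s = (count (mem (C j)) s)%:R.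
    rewrite /f -sum1_count big_tuple natr_sum [RHS]big_mkcond/=.
    by apply: eq_bigr => i _; rewrite indicE; case: (_ \in _).
  apply/seteqP; split => s /=; rewrite fE; first by move=> ->.
  by move=> /eqP; rewrite eqr_nat => /eqP.
rewrite -bigcap_seq; apply/seteqP; split => s /= h.
  by move=> j _; rewrite -h ffunE.
by apply/ffunP => j; rewrite ffunE; apply: h => /=; rewrite mem_index_enum.
Qed.

Lemma measurable_counts k (g : {ffun J -> nat} -> \bar R) :
  measurable_fun setT (fun s : k.-tuple T => g (counts s)).
Proof.
exact: (measurable_comp_countable (phi := fun s : k.-tuple T => counts s)
  g (@counts_fiber k)).
Qed.

Lemma measurable_counts2 k1 k2 (g : {ffun J -> nat} -> {ffun J -> nat} -> \bar R) :
  measurable_fun setT (fun s : k1.-tuple T * k2.-tuple T =>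
    g (counts s.1) (counts s.2)).
Proof.
apply: (measurable_comp_countable
  (phi := fun s : k1.-tuple T * k2.-tuple T => (counts s.1, counts s.2))
  (fun z => g z.1 z.2)) => -[x y].
rewrite (_ : _ @^-1` _ = [set s : k1.-tuple T | counts s = x] `*`
   [set s : k2.-tuple T | counts s = y]); first exact: measurableX (counts_fiber x) (counts_fiber y).
by apply/seteqP; split => -[s1 s2] /= => [[-> ->]|[-> ->]].
Qed.

Lemma counts_cons j (x : T) s : C j x -> counts (x :: s) = add_point j (counts s).
Proof.
move=> Cx; apply/ffunP => i; rewrite !ffunE /=; congr (_ + _)%N.
have [->|ij] := eqVneq i j; first by rewrite mem_set.
rewrite -[in LHS](_ : false = (x \in C i))//; apply/esym/negbTE/negP.
rewrite inE => Cix; move: ij; rewrite (tC (i := i) (j := j))//; last by exists x.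
by rewrite eqxx.
Qed.

Section one_sample.
Variables (P : probability T R) (p : J -> R).
Hypotheses (pE : forall j, P (C j) = (p j)%:E) (p1 : \sum_j p j = 1).

Lemma cell_prob_ge0 j : 0 <= p j.
Proof. by rewrite -lee_fin -pE measure_ge0. Qed.

Lemma integral_cells (f : T -> \bar R) (v : J -> \bar R) :
  measurable_fun setT f -> (forall x, 0 <= f x)%E ->
  (forall j x, C j x -> f x = v j) ->
  (\int[P]_x f x = \sum_j (p j)%:E * v j)%E.
Proof.
move=> mf f0 fv.
have tS : trivIset [set` index_enum J] C by exact: sub_trivIset tC.
have bigE (g : T -> \bar R) : measurable_fun setT g -> (forall x, 0 <= g x)%E ->
    (\int[P]_(x in \big[setU/set0]_(j : J) C j) g x =
     \sum_j \int[P]_(x in C j) g x)%E.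
  move=> mg g0; apply: ge0_integral_bigsetU => //; first exact: index_enum_uniq.
  exact: measurable_funTS.
set U := \big[setU/set0]_(j : J) C j in bigE *.
have mU : measurable U by apply: bigsetU_measurable.
have PU : P U = 1%E.
  have := bigE (cst 1%E) (measurable_cst _) (fun=> lee01).
  rewrite integral_cst// mul1e => ->.
  under eq_bigr => j _.
    rewrite integral_cst//.
    rewrite (_ : _ * _ = (p j)%:E)%E; last by rewrite mul1e; exact: pE.
    over.
  by rewrite sumEFin p1.
rewrite (@ge0_negligible_integral _ _ _ _ setT (~` U))//; last 2 first.
- exact: measurableC.
- by apply: etrans (probability_setC P mU) _; rewrite PU subee.
rewrite setTD setCK bigE//; apply: eq_bigr => j _.
rewrite (eq_integral (cst (v j))); last by move=> x; rewrite inE; exact: fv.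
by rewrite integral_cst// muleC; congr (_ * _)%E; exact: pE.
Qed.

(** The probability that k independent points have the cell counts x. *)
Definition multinom (p : J -> R) k (x : {ffun J -> nat}) : R :=
  if (\sum_j x j == k)%N then k`!%:R * \prod_j (p j ^+ x j / (x j)`!%:R) else 0.

Lemma multinom_ge0 k x : 0 <= multinom p k x.
Proof.
rewrite /multinom; case: ifP => // _; rewrite mulr_ge0// prodr_ge0// => j _.
by rewrite divr_ge0// exprn_ge0// cell_prob_ge0.
Qed.

Lemma sum_add_point j x : (\sum_i add_point j x i = (\sum_i x i).+1)%N.
Proof.
under eq_bigr do rewrite ffunE.
rewrite big_split/= (bigD1 j)//= eqxx big1 ?addn0 ?add1n// => i /negbTE ->//.
Qed.

(** Bayes: given the counts y of k + 1 points, the first point is in cell j with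
probability y_j / (k + 1).  These weights sum to one over j, which closes the
induction in [iid_counts]. *)
Lemma multinom_add_point k j x :
  p j * multinom p k x = (add_point j x j)%:R / k.+1%:R * multinom p k.+1 (add_point j x).
Proof.
rewrite /multinom sum_add_point eqSS; case: ifP => _; last by rewrite !mulr0.
rewrite (bigD1 j)//= [in RHS](bigD1 j)//= !ffunE eqxx add1n factS exprS.
under [in RHS]eq_bigr => i /negbTE ij do rewrite ffunE ij add0n.
set Q := \prod_(i | _) _; rewrite factS !natrM.
have nz n : (n`!%:R : R) != 0 by rewrite pnatr_eq0 -lt0n fact_gt0.
have n1z n : (1 + n%:R : R) != 0 by rewrite addrC natr1 pnatr_eq0.
by field; rewrite ?nz ?n1z.
Qed.

Lemma esum_add_point (j : J) (F : {ffun J -> nat} -> \bar R) :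
  (forall y : {ffun J -> nat}, y j = 0%N -> F y = 0%E) ->
  (\esum_(x in [set: {ffun J -> nat}]) F (add_point j x) =
   \esum_(y in [set: {ffun J -> nat}]) F y)%E.
Proof.
move=> F0; transitivity
    (\esum_(y in [set y : {ffun J -> nat} | y j <> 0%N]) F y)%E.
  symmetry; apply: (reindex_esum setT _ (add_point j)); split=> [x _ /=|x y _ _ /ffunP xy|y /= yj].
  - by rewrite ffunE eqxx.
  - by apply/ffunP => i; have := xy i; rewrite !ffunE => /addnI.
  exists [ffun i => y i - (i == j)]%N => //; apply/ffunP => i.
  rewrite !ffunE; case: eqVneq => [->|_]; last by rewrite add0n subn0.
  by rewrite subnKC// lt0n; apply/eqP.
rewrite esum_mkcond; apply: eq_esum => y _; case: ifPn => //.
by rewrite notin_setE /= => /contrapT /F0 ->.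
Qed.

(** The law of the counts, by conditioning on the cell of the first point. *)
Lemma iid_counts k (g : {ffun J -> nat} -> \bar R) : (forall x, 0 <= g x)%E ->
  (\int[iid P k]_s g (counts s) =
   \esum_(x in [set: {ffun J -> nat}]) (multinom p k x)%:E * g x)%E.
Proof.
elim: k g => [|k IH] g g0.
  rewrite /= integral_dirac//; last exact: measurable_counts.
  rewrite diracT mul1e.
  have c0 : counts [tuple] = [ffun=> 0%N] by apply/ffunP => j; rewrite !ffunE.
  rewrite c0 (esumID [set [ffun=> 0%N]]); last first.
    by move=> x _; rewrite mule_ge0// lee_fin multinom_ge0.
  rewrite setTI esum_set1; last by rewrite mule_ge0// lee_fin multinom_ge0.
  rewrite [X in (_ + X)%E]esum1 ?adde0.
    rewrite /multinom big1 ?eqxx; last by move=> j _; rewrite ffunE.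
    rewrite big1 ?mulr1 ?mul1e// => j _.
    by rewrite ffunE expr0 divr1.
  move=> x [_ /= x0]; rewrite /multinom; case: eqP; rewrite ?mul0e// => /eqP.
  rewrite sum_nat_eq0 => /forallP h; exfalso; apply: x0; apply/ffunP => j.
  by rewrite ffunE; apply/eqP/h.
rewrite /= ge0_integral_distribution//; last exact: measurable_counts.
rewrite fubini_tonelli1; last 2 first.
- apply: measurableT_comp; last exact: measurable_cons_pair.
  exact: measurable_counts.
- by move=> z; exact: g0.
rewrite (@integral_cells _ (fun j =>
  \esum_(x in [set: {ffun J -> nat}]) (multinom p k x)%:E * g (add_point j x))%E); last 3 first.
- apply: measurable_fun_fubini_tonelli_F; last by move=> z; exact: g0.
  apply: measurableT_comp; last exact: measurable_cons_pair.
  exact: measurable_counts.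
- by move=> x; apply: integral_ge0 => s _; exact: g0.
- move=> j x Cx; rewrite -(IH (fun s => g (add_point j s)))//.
  by apply: eq_integral => s _ /=; rewrite (counts_cons _ Cx).
transitivity (\sum_j \esum_(y in [set: {ffun J -> nat}])
  ((y j)%:R / k.+1%:R * multinom p k.+1 y)%:E * g y)%E.
  apply: eq_bigr => j _; rewrite -esumZl ?cell_prob_ge0//; last first.
    by move=> x; rewrite mule_ge0// lee_fin multinom_ge0.
  rewrite -(@esum_add_point j (fun y =>
    ((y j)%:R / k.+1%:R * multinom p k.+1 y)%:E * g y)%E); last first.
    by move=> y ->; rewrite !mul0r mul0e.
  by apply: eq_esum => x _; rewrite muleA -EFinM multinom_add_point.
rewrite -esum_sum; last first.
  by move=> y j _ _; rewrite mule_ge0// lee_fin mulr_ge0 ?multinom_ge0 ?divr_ge0.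
apply: eq_esum => y _; rewrite -ge0_sume_distrl; last first.
  by move=> j _; rewrite lee_fin mulr_ge0 ?multinom_ge0 ?divr_ge0.
congr (_ * _)%E; rewrite sumEFin -!mulr_suml -natr_sum.
rewrite /multinom; case: eqP => [->|_]; last by rewrite mulr0.
by rewrite divff ?mul1r// pnatr_eq0.
Qed.

(** For given counts x, only the sample size k = sum x_j contributes, and there
the factor k! of the multinomial law cancels that of the Poisson law: what is
left factors over the cells. *)
Lemma poisson_multinom n (h : {ffun J -> nat} -> \bar R) : 0 <= n ->
  (forall x, 0 <= h x)%E ->
  poisE n (fun k => \esum_(x in [set: {ffun J -> nat}]) (multinom p k x)%:E * h x)%E =
  (\esum_(x in [set: {ffun J -> nat}]) (\prod_j pois (n * p j) (x j))%:E * h x)%E.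
Proof.
move=> n0 h0; have m0 := multinom_ge0.
rewrite poisE_esum//; last first.
  by move=> k; apply: esum_ge0 => x _; rewrite mule_ge0// lee_fin.
transitivity (\esum_(k in [set: nat]) \esum_(x in [set: {ffun J -> nat}])
   ((pois n k * multinom p k x)%:E * h x))%E.
  apply: eq_esum => k _; rewrite -esumZl ?pois_ge0//; last first.
    by move=> x; rewrite mule_ge0// lee_fin.
  by apply: eq_esum => x _; rewrite muleA -EFinM.
rewrite esum_swap; last first.
  by move=> k x; rewrite mule_ge0// lee_fin mulr_ge0// pois_ge0.
apply: eq_esum => x _; set k := (\sum_j x j)%N.
rewrite (esumID [set k]); last first.
  by move=> i _; rewrite mule_ge0// lee_fin mulr_ge0// pois_ge0.
rewrite setTI esum_set1; last by rewrite mule_ge0// lee_fin mulr_ge0// pois_ge0.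
rewrite [X in (_ + X)%E]esum1 ?adde0; last first.
  move=> i [_ /= ik]; rewrite /multinom; case: eqP => [e|]; last by rewrite mulr0 mul0e.
  by case: ik; rewrite -e.
congr (_%:E * _)%E; rewrite /multinom eqxx /pois.
have nz i : (i`!%:R : R) != 0 by rewrite pnatr_eq0 -lt0n fact_gt0.
set Q := \prod_j (p j ^+ _ / _).
rewrite (_ : _ * _ = expR (- n) * (n ^+ k * Q)); last by field; exact: nz.
rewrite big_split/=; congr (_ * _).
  by rewrite prod_expR sumrN -mulr_sumr p1 mulr1.
rewrite /k -prodrXr -big_split/=; apply: eq_bigr => j _.
by rewrite exprMn mulrA.
Qed.

End one_sample.

End poissonization.

Section poisson_indep.
Context {R : realType}.

Lemma indep_esum (J : Type) (js : seq J) (mu : J -> R) (h : seq nat -> \bar R) :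
  (forall j, 0 <= mu j) -> (forall s, 0 <= h s)%E ->
  indep (fun j => poisE (mu j)) js h =
  (\esum_(s in [set s | size s = size js])
     (\prod_(z <- zip js s) pois (mu z.1) z.2)%:E * h s)%E.
Proof.
move=> mu0; have p0 j k := pois_ge0 k (mu0 j).
elim: js h => [|j js IH] h h0 /=.
  rewrite (_ : [set s | _] = [set [::]]); last first.
    by apply/seteqP; split => s /=; [move/size0nil|move->].
  by rewrite esum_set1 ?mule_ge0 ?lee_fin// big_nil ?mul1e ?ler01.
rewrite poisE_esum//; last first.
  by move=> x; apply: op_ge0 => // *; apply: op_indep => i; exact: op_pois.
transitivity (\esum_(x in [set: nat]) \esum_(s in [set s | size s = size js])
   ((pois (mu j) x * \prod_(z <- zip js s) pois (mu z.1) z.2)%:E * h (x :: s)))%E.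
  apply: eq_esum => x _; rewrite IH// -esumZl//; last first.
    by move=> s; rewrite mule_ge0// lee_fin prodr_ge0.
  by apply: eq_esum => s _; rewrite muleA -EFinM.
rewrite esum_esum; last first.
  by move=> x s _ _; rewrite mule_ge0// lee_fin mulr_ge0// prodr_ge0.
rewrite [RHS](reindex_esum
  (setT `*`` (fun _ : nat => [set s : seq nat | size s = size js])) _
  (fun z : nat * seq nat => z.1 :: z.2)); last first.
  split=> [[x s] [_ /= ->]//|[x s] [x' s'] _ _ /= [-> ->]//|[//|x s] /= [ss]].
  by exists (x, s).
by apply: eq_esum => -[x s] _ /=; rewrite big_cons.
Qed.

Lemma esum_ffun_indep (J : finType) (mu : J -> R) (h : seq nat -> \bar R) :
  (forall j, 0 <= mu j) -> (forall s, 0 <= h s)%E ->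
  (\esum_(x in [set: {ffun J -> nat}])
     (\prod_j pois (mu j) (x j))%:E * h [seq x j | j <- enum J])%E =
  indep (fun j => poisE (mu j)) (enum J) h.
Proof.
move=> mu0 h0; rewrite indep_esum//.
rewrite [RHS](reindex_esum [set: {ffun J -> nat}] _
  (fun x : {ffun J -> nat} => [seq x j | j <- enum J])); last first.
  split=> [x _ /=|x y _ _ /= xy|s /= ss].
  - by rewrite size_map.
  - apply/ffunP => j; have := congr1 (fun s => nth 0%N s (enum_rank j)) xy.
    have E (y' : {ffun J -> nat}) : nth 0%N [seq y' i | i <- enum J] (enum_rank j) = y' j.
      by rewrite (nth_map j) ?nth_enum_rank// -cardE.
    by rewrite !E.
  exists [ffun j => nth 0%N s (enum_rank j)] => //.
  apply: (@eq_from_nth _ 0%N); first by rewrite size_map.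
  move=> i; rewrite size_map -cardE => iJ.
  have j : J by apply: (enum_val (Ordinal iJ)).
  rewrite (nth_map j) -?cardE// ffunE; congr nth.
  by rewrite -[i in nth j _ i]/(val (Ordinal iJ)) -enum_val_nth enum_valK.
apply: eq_esum => x _; congr (_%:E * _)%E.
rewrite -big_enum/=; elim: (enum J) => [|j js IH] /=; first by rewrite !big_nil.
by rewrite !big_cons IH.
Qed.

Lemma indep_poisE_swap (J : Type) (js : seq J) (mu : J -> R) (b : R)
    (f : seq nat -> nat -> \bar R) :
  (forall j, 0 <= mu j) -> 0 <= b -> (forall s y, 0 <= f s y)%E ->
  indep (fun j => poisE (mu j)) js (fun s => poisE b (f s)) =
  poisE b (fun y => indep (fun j => poisE (mu j)) js (fun s => f s y)).
Proof.
move=> mu0 b0; elim: js f => [//|j js IH] f f0 /=.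
rewrite -poisE_swap//; first by congr (poisE _); apply/funext => x; rewrite IH.
by move=> x y; apply: op_ge0 => // *; apply: op_indep => i; exact: op_pois.
Qed.

Lemma indep_pair (J : Type) (js : seq J) (mu nu : J -> R)
    (f : seq (nat * nat) -> \bar R) :
  (forall j, 0 <= mu j) -> (forall j, 0 <= nu j) -> (forall s, 0 <= f s)%E ->
  indep (fun j => poisE (mu j)) js (fun xs =>
     indep (fun j => poisE (nu j)) js (fun ys => f (zip xs ys))) =
  indep (fun j => cellE (mu j) (nu j)) js f.
Proof.
move=> mu0 nu0; elim: js f => [//|j js IH] f f0 /=.
rewrite /cellE /prodE; congr (poisE _); apply/funext => x.
rewrite indep_poisE_swap//; last first.
  by move=> s y; apply: op_ge0 => // *; apply: op_indep => i; exact: op_pois.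
by congr (poisE _); apply/funext => y; rewrite -(IH (fun s => f ((x, y) :: s))).
Qed.

Lemma integral_poisson_prob (n : R) (h : nat -> \bar R) : 0 < n ->
  (forall k, 0 <= h k)%E -> (\int[poisson_prob n 0]_k h k)%E = poisE n h.
Proof.
move=> n0 h0.
have -> : [set: nat] = \bigcup_k [set k] by apply/seteqP; split => // k _; exists k.
rewrite ge0_integral_bigcup//; last by move=> i j _ _ [k [/= -> ->]].
apply: eq_eseriesr => k _.
rewrite (eq_integral (cst (h k))); last by move=> i; rewrite inE /= => ->.
rewrite integral_cst// muleC; congr (_ * _)%E.
transitivity (poisson_pmf n k)%:E; last by rewrite /poisson_pmf n0 /pois mulrC.
by rewrite /= /poisson_prob n0 esum_set1// lee_fin poisson_pmf_ge0.
Qed.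

End poisson_indep.

Lemma measurable_nat_pair (R : realType) (g : nat * nat -> \bar R) :
  measurable_fun [set: nat * nat] g.
Proof.
have mpt (z : nat * nat) : measurable (id @^-1` [set z]).
  case: z => a b; rewrite (_ : _ @^-1` _ = [set a] `*` [set b]).
    exact: measurableX.
  by apply/seteqP; split => -[x y] /= [-> ->].
exact: (measurable_comp_countable g mpt).
Qed.

Section two_samples.
Context d (T : measurableType d) (R : realType) (J : finType) (C : J -> set T).
Hypotheses (mC : forall j, measurable (C j)) (tC : trivIset [set: J] C).
Variables (P Q : probability T R) (p q : J -> R).
Hypotheses (pE : forall j, P (C j) = (p j)%:E) (p1 : \sum_j p j = 1).
Hypotheses (qE : forall j, Q (C j) = (q j)%:E) (q1 : \sum_j q j = 1).

Lemma poisson_two_samples n (f : {ffun J -> nat} -> {ffun J -> nat} -> \bar R) :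
  0 < n -> (forall x y, 0 <= f x y)%E ->
  (\int[poisson_prob n 0 \x poisson_prob n 0]_k
    \int[iid P k.1 \x iid Q k.2]_s f (counts C s.1) (counts C s.2) =
  \esum_(x in [set: {ffun J -> nat}]) (\prod_j pois (n * p j) (x j))%:E *
    \esum_(y in [set: {ffun J -> nat}]) (\prod_j pois (n * q j) (y j))%:E * f x y)%E.
Proof.
move=> n0 f0; have n0' := ltW n0.
have m0 k x := multinom_ge0 pE k x; have m0' k x := multinom_ge0 qE k x.
pose H k x : \bar R := (\esum_(y in [set: {ffun J -> nat}]) (multinom q k y)%:E * f x y)%E.
have H0 k x : (0 <= H k x)%E.
  by apply: esum_ge0 => y _; rewrite mule_ge0// lee_fin.
have innerE k1 k2 : (\int[iid P k1 \x iid Q k2]_s f (counts C s.1) (counts C s.2) =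
   \esum_(x in [set: {ffun J -> nat}]) (multinom p k1 x)%:E * H k2 x)%E.
  rewrite fubini_tonelli1; last 2 first.
  - exact: measurable_counts2.
  - by move=> z; exact: f0.
  rewrite -(iid_counts mC tC pE p1)//; apply: eq_integral => s _.
  exact: (iid_counts mC tC qE q1 k2 (f0 (counts C s))).
under eq_integral do rewrite innerE.
have I0 k1 k2 : (0 <= \esum_(x in [set: {ffun J -> nat}]) (multinom p k1 x)%:E * H k2 x)%E.
  by apply: esum_ge0 => x _; rewrite mule_ge0// lee_fin.
rewrite (fubini_tonelli1 (fun k => \esum_(x in [set: {ffun J -> nat}])
   (multinom p k.1 x)%:E * H k.2 x)%E); last 2 first.
- exact: measurable_nat_pair.
- by move=> k; exact: I0.
rewrite /fubini_F integral_poisson_prob//; last by move=> k; exact: integral_ge0.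
under eq_fun do rewrite integral_poisson_prob//.
pose G x : \bar R := (\esum_(y in [set: {ffun J -> nat}])
  (\prod_j pois (n * q j) (y j))%:E * f x y)%E.
have HG x : poisE n (H ^~ x) = G x by exact: (poisson_multinom qE q1).
have G0 x : (0 <= G x)%E by rewrite -HG; apply: op_ge0 => //; exact: op_pois.
rewrite -[RHS](poisson_multinom pE p1 n0' G0); congr (poisE n); apply/funext => k1.
rewrite poisE_esum//.
transitivity (\esum_(k in [set: nat]) \esum_(x in [set: {ffun J -> nat}])
   ((multinom p k1 x)%:E * ((pois n k)%:E * H k x)))%E.
  apply: eq_esum => k _; rewrite -esumZl ?pois_ge0//; last first.
    by move=> x; rewrite mule_ge0// lee_fin.
  by apply: eq_esum => x _; rewrite muleCA.
rewrite esum_swap; last first.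
  by move=> k x; rewrite !mule_ge0// lee_fin// pois_ge0.
apply: eq_esum => x _; rewrite esumZl//; last first.
  by move=> k; rewrite mule_ge0// lee_fin pois_ge0.
by rewrite -HG poisE_esum.
Qed.

End two_samples.

Section chi2_power.
Context {R : realType} {d : nat}.
Local Notation point := (d.-tuple (measurableTypeR R)).

(** The power of the test only depends on the masses of the cells, and the
counts behave as independent Poisson variables. *)
Lemma expect_power (n t : R) (K : nat) (P Q : probability point R)
    (p q : d.-tuple 'I_K -> R) : 0 < n ->
  (forall j : d.-tuple 'I_K, measurable (cell j : set point)) ->
  trivIset [set: d.-tuple 'I_K] (fun j : d.-tuple 'I_K => cell j : set point) ->
  (forall j, P (cell j) = (p j)%:E) -> \sum_j p j = 1 ->
  (forall j, Q (cell j) = (q j)%:E) -> \sum_j q j = 1 ->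
  expect n P Q (chi2_test K t) =
  power (fun j => cellE (n * p j) (n * q j)) (enum {: d.-tuple 'I_K}) t.
Proof.
move=> n0 mC tC pE p1 qE q1.
have n0' := ltW n0.
have p0 j : 0 <= n * p j by rewrite mulr_ge0// -lee_fin -pE measure_ge0.
have q0 j : 0 <= n * q j by rewrite mulr_ge0// -lee_fin -qE measure_ge0.
pose S (x y : {ffun d.-tuple 'I_K -> nat}) :=
  zip [seq x j | j <- enum {: d.-tuple 'I_K}] [seq y j | j <- enum {: d.-tuple 'I_K}].
have F0 x y : (0 <= ((t < \sum_(z <- S x y) sqdiff z)%R%:R : R)%:E)%E by rewrite lee_fin.
transitivity (\int[poisson_prob n 0 \x poisson_prob n 0]_k
    \int[iid P k.1 \x iid Q k.2]_s
     ((t < \sum_(z <- S (counts (fun j : d.-tuple 'I_K => cell j : set point) s.1)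
       (counts (fun j : d.-tuple 'I_K => cell j : set point) s.2)) sqdiff z)%R%:R : R)%:E)%E.
  rewrite /expect; apply: eq_integral => k _; apply: eq_integral => s _.
  congr (_%:E); rewrite /chi2_test /chi2_stat.
  set a := \sum_j _; set b := \sum_(_ <- _) _.
  suff -> : a = b by case: (t < b).
  rewrite /a /b /S -big_enum/=; elim: (enum _) => [|j js IH] /=; first by rewrite !big_nil.
  by rewrite !big_cons -IH /sqdiff /= !ffunE.
rewrite (poisson_two_samples mC tC pE p1 qE q1 n0 F0).
rewrite /power -indep_pair//.
rewrite -esum_ffun_indep//; last first.
  move=> xs; apply: op_ge0 => [|ys]; last by rewrite lee_fin.
  by apply: op_indep => j; exact: op_pois.
apply: eq_esum => x _; congr (_ * _)%E.
by rewrite -esum_ffun_indep.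
Qed.

End chi2_power.

(** * Masses of the cells *)
Lemma measure_bigsetU_finType d (T : measurableType d) (R : realType)
    (P : {measure set T -> \bar R}) (J : finType) (F : J -> set T) :
  (forall j, measurable (F j)) -> trivIset [set: J] F ->
  (P (\big[setU/set0]_(j : J) F j) = \sum_j P (F j))%E.
Proof.
move=> mF tF.
have := @ge0_integral_bigsetU _ _ _ P _ F (cst 1%E) (index_enum J) mF
  (index_enum_uniq J) (sub_trivIset (@subsetT _ _) tF) (measurable_cst _)
  (fun _ _ => lee01).
rewrite integral_cst; last exact: bigsetU_measurable.
rewrite mul1e => ->; apply: eq_bigr => j _.
by rewrite integral_cst// mul1e.
Qed.

Section cells.
Context {R : realType} {d : nat}.
Local Notation point := (d.-tuple (measurableTypeR R)).
Local Notation law := (probability point R).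

Lemma measurable_cell K (j : d.-tuple 'I_K) : measurable (cell j : set point).
Proof.
apply: measurableI; last exact: measurable_shifted_cube.
by apply: measurable_box => i; exact: measurable_itv.
Qed.

Lemma trivIset_cell K :
  trivIset [set: d.-tuple 'I_K] (fun j : d.-tuple 'I_K => cell j : set point).
Proof.
move=> j j' _ _ [x [[_ xj] [_ xj']]]; apply: eq_from_tnth => i.
have /= := xj i; have /= := xj' i; rewrite !in_itv/= /vertex !subr0.
set a := tnth j' i; set b := tnth j i.
have K0 : 0 < K%:R :> R by rewrite ltr0n (leq_ltn_trans _ (ltn_ord a)).
have E (c : 'I_K) : c.+1%:R / K%:R - K%:R^-1 = c%:R / K%:R :> R.
  by rewrite -natr1 mulrDl mul1r addrK.
rewrite !E => /andP[a1 a2] /andP[b1 b2].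
have := lt_le_trans a1 b2; have := lt_le_trans b1 a2.
rewrite !ltr_pM2r ?invr_gt0// !ltr_nat !ltnS => ba ab.
by apply/val_inj/eqP; rewrite eqn_leq ba ab.
Qed.

Lemma prob_setI_full (P : law) (A B : set point) : measurable A -> measurable B ->
  P A = 1%E -> P (A `&` B) = P B.
Proof.
move=> mA mB PA.
rewrite -[in RHS](setIT B) -(setUv A) setIUr measureU//; last 3 first.
- exact: measurableI.
- by apply: measurableI => //; exact: measurableC.
- by rewrite setIACA setICr setI0.
rewrite [X in (_ + X)%E](_ : _ = 0%E) ?adde0 1?setIC//.
apply: (@subset_measure0 _ _ _ P _ (~` A)) => //.
- by apply: measurableI => //; exact: measurableC.
- exact: measurableC.
- by apply: etrans (probability_setC P mA) _; rewrite PA subee.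
Qed.

Lemma unif_omega : (unif : law) omega = 1%E.
Proof.
rewrite /unif /omega iid_box// big1// => i _.
rewrite /= /uniform_prob (eq_integral (fun=> 1%E)); last first.
  move=> x; rewrite inE/= in_itv/= => /andP[ax xb].
  by rewrite /uniform_pdf (ltW ax) (ltW xb) subr0 invr1.
by rewrite integral_cst//= mul1e lebesgue_measure_itv/= lte_fin ltr01 oppr0 adde0.
Qed.

Lemma unif_cell K (j : d.-tuple 'I_K) :
  (unif : law) (cell j) = (K%:R ^- d)%:E.
Proof.
rewrite prob_setI_full; last 3 first.
- by apply: measurable_box => i; exact: measurable_itv.
- exact: measurable_shifted_cube.
- exact: unif_omega.
rewrite unif_shifted_cube ?invr_ge0//.
by rewrite subr0 prodEFin prodr_const card_ord exprVn.
Qed.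

Lemma sum_cells K : (0 < K)%N -> \sum_(j : d.-tuple 'I_K) (K%:R ^- d : R) = 1.
Proof.
move=> K0; rewrite sumr_const card_tuple card_ord -[_ *+ (K ^ d)]mulr_natr natrX.
by rewrite mulVf// expf_neq0// pnatr_eq0 -lt0n.
Qed.

Section alternative.
Variables (K M : nat) (j0 : d.-tuple 'I_M).
Hypothesis K0 : (0 < K)%N.

Let M0 : 0 <= M%:R^-1 :> R. Proof. by rewrite invr_ge0. Qed.
Let mL : measurable (cellL j0 : set point) := measurable_shifted_cube j0 _ _.
Let mR : measurable (cellR j0 : set point) := measurable_shifted_cube j0 _ _.

Lemma unif_cellL : (unif : law) (cellL j0) = ((M%:R^-1 / 2) ^+ d)%:E.
Proof.
have [h1 h2] : 0 <= M%:R^-1 / 2 :> R /\ M%:R^-1 / 2 <= M%:R^-1 :> R.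
  by have := M0; lra.
rewrite unif_shifted_cube//.
by rewrite prodEFin prodr_const card_ord; congr (_ ^+ _)%:E; lra.
Qed.

Lemma unif_cellR : (unif : law) (cellR j0) = ((M%:R^-1 / 2) ^+ d)%:E.
Proof.
have [h1 h2] : 0 <= M%:R^-1 / 2 :> R /\ M%:R^-1 / 2 <= M%:R^-1 :> R.
  by have := M0; lra.
rewrite unif_shifted_cube//.
by rewrite prodEFin prodr_const card_ord subr0.
Qed.

(** The negative part of the density is moved to the left, so that both sides
are integrals of nonnegative functions. *)
Lemma tilted_split (A : set point) : measurable A ->
  ((tilted j0 A : \bar R) + 2^-1%:E * (unif : law) (A `&` cellR j0) =
   (unif : law) A + 2^-1%:E * (unif : law) (A `&` cellL j0))%E.
Proof.
move=> mA.
have half (B : set point) : measurable B ->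
    (\int[unif]_(x in A) (2^-1 * \1_B x)%:E = 2^-1%:E * (unif : law) (A `&` B))%E.
  move=> mB; under eq_integral do rewrite EFinM.
  rewrite ge0_integralZl//; first by rewrite integral_indic// setIC.
  by apply/measurable_EFinP; apply: measurable_funTS; exact: measurable_indic.
have mhalf (B : set point) : measurable B ->
    measurable_fun A (fun x => (2^-1 * \1_B x : R)%:E).
  move=> mB; apply: measurable_funTS; apply/measurable_EFinP.
  exact: measurable_funM.
rewrite -!half// /tilted -ge0_integralD//; last 3 first.
- by move=> x _; rewrite lee_fin tilted_density_ge0.
- by apply: measurable_funTS; exact: measurable_tilted_density.
- exact: mhalf.
rewrite -[X in (X + _)%E]mul1e -integral_cst// -ge0_integralD//; last exact: mhalf.
apply: eq_integral => x _; rewrite -!EFinD; congr (_%:E).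
by rewrite /phi; ring.
Qed.

Lemma tilted_null (A : set point) : measurable A -> (unif : law) A = 0%E ->
  tilted j0 A = 0%E :> \bar R.
Proof.
move=> mA A0; have := tilted_split mA.
have sub0 B : measurable B -> (unif : law) (A `&` B) = 0%E.
  move=> mB; apply: (@subset_measure0 _ _ _ (unif : law) _ A) => //.
  exact: measurableI.
by rewrite !sub0// A0 mule0 !adde0.
Qed.

Definition tilted_mass (j : d.-tuple 'I_K) : R := fine (tilted j0 (cell j)).

Let Q : law := tilted j0.

Lemma tilted_massE j : Q (cell j) = (tilted_mass j)%:E.
Proof. by rewrite /tilted_mass fineK// (fin_num_measure Q)//; exact: measurable_cell. Qed.

Lemma sum_cells_le (P : law) (A : set point) : measurable A ->
  (\sum_(j : d.-tuple 'I_K) P (cell j `&` A) <= P A)%E.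
Proof.
move=> mA.
have mcA (j : d.-tuple 'I_K) : measurable (cell j `&` A).
  by apply: measurableI => //; exact: measurable_cell.
rewrite -measure_bigsetU_finType//; last first.
  by apply: trivIset_setIr; exact: trivIset_cell.
apply: le_measure; rewrite ?inE//; first exact: bigsetU_measurable.
by rewrite -bigcup_seq => x [j _ []].
Qed.

(** The cells have total uniform mass one, so what they leave out is null for
the uniform law and hence for the tilted one. *)
Lemma sum_tilted_mass : \sum_j tilted_mass j = 1.
Proof.
have mU : measurable (\big[setU/set0]_(j : d.-tuple 'I_K) (cell j : set point)).
  by apply: bigsetU_measurable => j _; exact: measurable_cell.
have U1 (P : law) : P (\big[setU/set0]_(j : d.-tuple 'I_K) (cell j : set point)) =
    (\sum_(j : d.-tuple 'I_K) P (cell j))%E.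
  apply: measure_bigsetU_finType; last exact: trivIset_cell.
  by move=> j; exact: measurable_cell.
have uU : (unif : law) (\big[setU/set0]_(j : d.-tuple 'I_K) (cell j : set point)) = 1%E.
  rewrite U1 -[RHS]/((1 : R)%:E) -(sum_cells K0) -sumEFin.
  by apply: eq_bigr => j _; rewrite unif_cell.
have QU : Q (\big[setU/set0]_(j : d.-tuple 'I_K) (cell j : set point)) = 1%E.
  rewrite -[X in Q X]setCK.
  apply: etrans (probability_setC Q (measurableC mU)) _.
  rewrite [X in (_ - X)%E](_ : _ = 0%E) ?sube0//.
  apply: tilted_null; first exact: measurableC.
  by apply: etrans (probability_setC _ mU) _; rewrite uU subee.
apply/EFin_inj; rewrite -sumEFin -QU U1; apply: eq_bigr => j _.
by rewrite tilted_massE.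
Qed.

Let a (j : d.-tuple 'I_K) : R := fine ((unif : law) (cell j `&` cellL j0)).
Let b (j : d.-tuple 'I_K) : R := fine ((unif : law) (cell j `&` cellR j0)).

Let aE j : (unif : law) (cell j `&` cellL j0) = (a j)%:E.
Proof.
rewrite /a fineK// (fin_num_measure (unif : law))//.
by apply: measurableI => //; exact: measurable_cell.
Qed.

Let bE j : (unif : law) (cell j `&` cellR j0) = (b j)%:E.
Proof.
rewrite /b fineK// (fin_num_measure (unif : law))//.
by apply: measurableI => //; exact: measurable_cell.
Qed.

Let devE j : tilted_mass j - K%:R ^- d = (a j - b j) / 2.
Proof.
have := tilted_split (measurable_cell j).
rewrite -[X in (X + _)%E]/(Q (cell j)) tilted_massE.
rewrite -[X in (_ = X + _)%E]/((unif : law) (cell j)) unif_cell aE bE.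
by rewrite -!EFinM -!EFinD => /(congr1 fine) /=; lra.
Qed.

Let a_ge0 j : 0 <= a j. Proof. by rewrite -lee_fin -aE. Qed.
Let b_ge0 j : 0 <= b j. Proof. by rewrite -lee_fin -bE. Qed.

Let dev_le j : `|tilted_mass j - K%:R ^- d| <= (a j + b j) / 2.
Proof. by rewrite devE ler_norml; have := a_ge0 j; have := b_ge0 j; lra. Qed.

Lemma tilted_mass_dev j : `|tilted_mass j - K%:R ^- d| <= K%:R ^- d.
Proof.
apply: le_trans (dev_le j) _.
have le_cell (A : set point) : measurable A ->
    ((unif : law) (cell j `&` A) <= (K%:R ^- d)%:E)%E.
  move=> mA; rewrite -(unif_cell j); apply: le_measure; rewrite ?inE//.
  - by apply: measurableI => //; exact: measurable_cell.
  - exact: measurable_cell.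
have := le_cell _ mL; have := le_cell _ mR; rewrite aE bE !lee_fin; lra.
Qed.

(** A cell deviates by half the difference of its intersections with the two
half-cubes, and the cells are disjoint. *)
Lemma sum_tilted_mass_dev :
  \sum_j `|tilted_mass j - K%:R ^- d| <= (M%:R ^- d : R).
Proof.
have sa : \sum_j a j <= (M%:R^-1 / 2) ^+ d.
  rewrite -lee_fin -sumEFin -unif_cellL; under eq_bigr do rewrite -aE.
  exact: sum_cells_le.
have sb : \sum_j b j <= (M%:R^-1 / 2) ^+ d.
  rewrite -lee_fin -sumEFin -unif_cellR; under eq_bigr do rewrite -bE.
  exact: sum_cells_le.
have sab : \sum_j `|tilted_mass j - K%:R ^- d| <= (\sum_j a j + \sum_j b j) / 2.
  rewrite -big_split/= mulr_suml; apply: ler_sum => j _; exact: dev_le.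
have MM : (M%:R^-1 / 2) ^+ d <= M%:R ^- d :> R.
  by rewrite -exprVn lerXn2r ?nnegrE ?divr_ge0//; have := M0; lra.
by lra.
Qed.

End alternative.
End cells.

(** * The normal quantile *)
Section normal_quantile.
Context {R : realType}.
Local Notation mu := (@lebesgue_measure R).

(** Beyond y the normal density is dominated by a multiple of the exponential
density of rate y, because x^2 / 2 >= x y - y^2 / 2. *)
Lemma normal_tail (y : R) : 0 < y ->
  (normal_prob 0 1 `]y, +oo[ <= (y ^- 2)%:E)%E.
Proof.
move=> y0.
have one0 : (1 : R) != 0 by exact: oner_neq0.
have exp_tail : (\int[mu]_(x in `]y, +oo[) (exponential_pdf y x)%:E <=
    (expR (- y ^+ 2))%:E)%E.
  have e0 x : (0 <= (exponential_pdf y x)%:E)%E.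
    by rewrite lee_fin exponential_pdf_ge0// ltW.
  have me : measurable_fun [set: R] (fun x => (exponential_pdf y x)%:E).
    by apply/measurable_EFinP; exact: measurable_exponential_pdf.
  have : (\int[mu]_(x in `]y, +oo[ `|` `[0%R, y]) (exponential_pdf y x)%:E <= 1)%E.
    rewrite -(integral_exponential_pdf y0); apply: ge0_subset_integral => //.
    exact: measurableU.
  rewrite ge0_integral_setU//=; last 2 first.
  - exact: measurable_funTS.
  - apply/disj_setPS => x [] /=; rewrite !in_itv/= andbT => yx /andP[_ xy].
    by have := lt_le_trans yx xy; rewrite ltxx.
  rewrite -[X in (_ + X <= _)%E]/(exponential_prob y `[0%R, y]).
  rewrite exponential_prob_itv0c// -leeBrDr//.
  move=> /le_trans; apply.
  by rewrite -!EFinB lee_fin mulNr -expr2; lra.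
have y2 : 0 < y ^+ 2 by rewrite exprn_gt0.
pose c := expR (y ^+ 2 / 2) / y.
have c0 : 0 <= c by rewrite divr_ge0 ?expR_ge0// ltW.
apply: (@le_trans _ _ (\int[mu]_(x in `]y, +oo[) (c%:E * (exponential_pdf y x)%:E))%E).
  apply: ge0_le_integral => //.
  - by move=> x _; rewrite lee_fin normal_pdf_ge0.
  - by apply/measurable_EFinP; apply: measurable_funTS; exact: measurable_normal_pdf.
  - apply: measurable_funTS; apply/measurable_EFinP; apply: measurable_funM => //.
    exact: measurable_exponential_pdf.
  move=> x /=; rewrite in_itv/= andbT => yx; have x0 := lt_trans y0 yx.
  rewrite -EFinM lee_fin exponential_pdfE ?(ltW x0)// normal_pdfE//.
  rewrite /c mulrA divfK ?gt_eqF// -expRD.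
  have peak1 : normal_peak 1 <= 1 :> R.
    rewrite /normal_peak invf_le1; last first.
      by rewrite sqrtr_gt0 expr1n mul1r mulrn_wgt0// pi_gt0.
    rewrite -[leLHS]sqrtr1 ler_wsqrtr// expr1n mul1r -mulr_natr.
    by have := @pi_ge2 R; lra.
  apply: (@le_trans _ _ (1 * normal_fun 0 1 x)).
    by rewrite ler_wpM2r// normal_fun_ge0.
  rewrite mul1r /normal_fun ler_expR subr0 expr1n.
  have : 0 <= (x - y) ^+ 2 by exact: sqr_ge0.
  have -> : (x - y) ^+ 2 = x ^+ 2 - 2 * (y * x) + y ^+ 2 by ring.
  by rewrite !mulNr; lra.
rewrite ge0_integralZl//; last 2 first.
- by apply: measurable_funTS; apply/measurable_EFinP; exact: measurable_exponential_pdf.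
- by move=> x _; rewrite lee_fin exponential_pdf_ge0// ltW.
apply: (@le_trans _ _ (c%:E * (expR (- y ^+ 2))%:E)%E).
  by rewrite lee_wpmul2l// lee_fin.
rewrite -EFinM lee_fin /c mulrAC -expRD.
rewrite (_ : y ^+ 2 / 2 - y ^+ 2 = - (y ^+ 2 / 2)); last by lra.
rewrite -[leRHS]mul1r -[y ^- 2](_ : y^-1 / y = _); last by rewrite expr2 invfM.
rewrite mulrA ler_pM2r ?invr_gt0// mul1r expRN lef_pV2 ?posrE ?expR_gt0//.
apply: le_trans (expR_ge1Dx _).
have : 0 <= (y - 1) ^+ 2 by exact: sqr_ge0.
have -> : (y - 1) ^+ 2 = y ^+ 2 - 2 * y + 1 by ring.
lra.
Qed.

(** Otherwise y = 1 / sqrt alpha is below the quantile, so the tail beyond y has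
mass more than alpha, whereas [normal_tail] bounds it by y^-2 = alpha. *)
Lemma level_le_quantile (alpha : R) : 0 < alpha < 1 ->
  0 < normal_quantile (1 - alpha) ->
  alpha <= normal_quantile (1 - alpha) ^- 2.
Proof.
move=> /andP[a0 a1] z0; set z := normal_quantile (1 - alpha) in z0 *.
rewrite -[z]/(inf [set z | _]) in z0 *; set A := [set _ | _] in z0 *.
rewrite leNgt; apply/negP => za.
pose y := (Num.sqrt alpha)^-1.
have s0 : 0 < Num.sqrt alpha by rewrite sqrtr_gt0.
have y0 : 0 < y by rewrite invr_gt0.
have y2 : y ^- 2 = alpha by rewrite exprVn invrK sqr_sqrtr// ltW.
have yz : y < inf A.
  by move: za; rewrite -y2 ltf_pV2 ?posrE ?exprn_gt0// ltr_pXn2r// nnegrE ltW.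
have hA : has_inf A.
  by apply: contrapT => /inf_out i0; move: z0; rewrite i0 ltxx.
have : ~ A y by move=> /(ge_inf (proj2 hA)); rewrite leNgt yz.
rewrite /A /= => /negP; rewrite -ltNge => PA.
have := normal_tail y0; rewrite y2 leNgt => /negP; apply.
have -> : normal_prob 0 1 `]y, +oo[ = (1 - normal_prob 0 1 `]-oo, y])%E.
  rewrite -setCitvl; exact: probability_setC.
have fN : normal_prob 0 1 `]-oo, y] \is a fin_num by exact: fin_num_measure.
by move: PA; rewrite -(fineK fN) -EFinB !lte_fin; lra.
Qed.

End normal_quantile.

(** * The theorem *)
Lemma inv_nat_gt0 (R : realType) (x : R) (K : nat) :
  0 < x < 1 -> x^-1 = K%:R -> (0 < K)%N.
Proof. by move=> /andP[x0 _] xK; rewrite -(ltr0n R) -xK invr_gt0. Qed.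

Lemma sum_sqr_dev_le (R : realType) (J : Type) (js : seq J) (e : J -> R) (B S : R) :
  0 <= B -> (forall j, `|e j| <= B) -> \sum_(j <- js) `|e j| <= S ->
  \sum_(j <- js) e j ^+ 2 <= B * S.
Proof.
move=> B0 eB eS; apply: (@le_trans _ _ (B * \sum_(j <- js) `|e j|)).
  rewrite mulr_sumr; apply: ler_sum => j _.
  by rewrite -(real_normK (num_real (e j))) expr2 ler_wpM2r.
by rewrite ler_wpM2l.
Qed.

Theorem theorem3 (R : realType) (d : nat) (alpha : R) :
  (2 <= d)%N -> 0 < alpha < 1 ->
  exists c N : R, 0 < c /\
    forall (n eps eta t : R) (K M : nat),
      0 < eps < 1 -> eps^-1 = K%:R ->
      0 < eta < 1 -> eta^-1 = M%:R ->
      (expect n (@unif R d) unif (chi2_test K t) <= alpha%:E)%E ->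
      N <= n ->
      eta <= c * n `^ (- (2 / (3 * d%:R))) ->
      exists P Q, local_alternatives R d M (P, Q) /\
        (expect n P Q (chi2_test K t) <=
           (let z := normal_quantile (1 - alpha) in
            if (0 < z)%R then (2 / z ^+ 2)%:E else +oo))%E.
Proof.
move=> d2 a01; have [kappa [N [k0 k1 N0 main]]] := counts_power_le a01.
have d0 : (0 < d)%N by exact: leq_trans d2.
exists kappa, (Num.max 1 N); split => // n eps eta t K M eps01 epsK eta01 etaM.
rewrite ge_max => size_ok /andP[n1 nN] etan.
have K0 := inv_nat_gt0 eps01 epsK; have M0 := inv_nat_gt0 eta01 etaM.
have n0 : 0 < n by exact: lt_le_trans n1.
have /andP[eta0 eta1] := eta01.
pose j0 : d.-tuple 'I_M := [tuple of nseq d (Ordinal M0)].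
exists unif, (tilted j0 : probability _ _); split; first by exists j0.
have mC := @measurable_cell R d K; have tC := @trivIset_cell R d K.
have uC (j : d.-tuple 'I_K) := unif_cell (R := R) j.
have u1 := sum_cells (R := R) (d := d) K0.
pose q := @tilted_mass R d K M j0.
(* The volumes eps^d and eta^d of the cells of the two partitions. *)
pose x : R := K%:R ^- d; pose y : R := M%:R ^- d.
have x0 : 0 < x by rewrite invr_gt0 exprn_gt0// ltr0n.
have y0 : 0 < y by rewrite invr_gt0 exprn_gt0// ltr0n.
rewrite (expect_power t n0 mC tC uC u1 uC u1) in size_ok.
rewrite (expect_power t n0 mC tC uC u1 (tilted_massE j0) (sum_tilted_mass j0 K0)).
pose e j := n * (q j - x).
pose js := enum {: d.-tuple 'I_K}.
have sJ : (size js)%:R = x^-1 :> R.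
  by rewrite -cardE card_tuple card_ord natrX invrK.
have lJ : n * x * (size js)%:R = n by rewrite sJ mulfK// gt_eqF.
have sumJ (f : d.-tuple 'I_K -> R) : \sum_(j <- js) f j = \sum_j f j.
  by rewrite /js big_enum.
have absE j : `|e j| = n * `|q j - x| by rewrite /e normrM (ger0_norm (ltW n0)).
have sum_abs : \sum_(j <- js) `|e j| <= n * y.
  rewrite sumJ; under eq_bigr do rewrite absE.
  by rewrite -mulr_sumr ler_wpM2l ?(ltW n0)//; exact: sum_tilted_mass_dev.
have absx j : `|e j| <= n * x.
  by rewrite absE ler_wpM2l ?(ltW n0)//; exact: tilted_mass_dev.
have absy j : `|e j| <= n * y.
  apply: le_trans sum_abs; rewrite sumJ (bigD1 j)//= lerDl.
  by rewrite sumr_ge0.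
have yeta : y = eta ^+ d by rewrite /y -etaM exprVn invrK.
(* The exponent in the condition on eta is such that n cancels here. *)
have y3 : n ^+ 2 * y ^+ 3 <= kappa ^+ 2.
  rewrite yeta -exprM mulnC.
  apply: (@le_trans _ _ (n ^+ 2 * (kappa * n `^ (- (2 / (3 * d%:R)))) ^+ (3 * d))).
    rewrite ler_wpM2l ?exprn_ge0 ?(ltW n0)// lerXn2r ?nnegrE ?(ltW eta0)//.
    by rewrite mulr_ge0 ?powR_ge0 ?(ltW k0).
  rewrite exprMn -[(n `^ _) ^+ _]powR_mulrn ?powR_ge0// -powRrM.
  have -> : - (2 / (3 * d%:R)) * (3 * d)%:R = - 2 :> R.
    by rewrite natrM; field; rewrite pnatr_eq0 -lt0n.
  rewrite -[n ^+ 2]powR_mulrn ?(ltW n0)// mulrCA -powRD; last by apply/implyP => _; rewrite gt_eqF.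
  rewrite subrr powRr0 mulr1.
  rewrite ler_wiXn2l ?(ltW k0)//.
  by rewrite (leq_trans _ (leq_pmulr _ d0)).
have yk : y <= kappa.
  have etak : eta <= kappa.
    apply: le_trans etan _; rewrite ler_piMr ?(ltW k0)//.
    rewrite -[leRHS](powRr0 n); apply: ler_powR => //.
  rewrite yeta; apply: le_trans etak.
  by rewrite -[leRHS]expr1 ler_wiXn2l ?(ltW eta0) ?(ltW eta1).
(* The bounds |e_j| <= n x and |e_j| <= n y combine to |e_j| <= n sqrt (x y). *)
pose sx := Num.sqrt x; pose sy := Num.sqrt y.
have sx0 : 0 < sx by rewrite sqrtr_gt0.
have sy0 : 0 < sy by rewrite sqrtr_gt0.
have sx2 : sx ^+ 2 = x by rewrite sqr_sqrtr// ltW.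
have sy2 : sy ^+ 2 = y by rewrite sqr_sqrtr// ltW.
have nyk : n * y * sy <= kappa.
  rewrite -(@ler_pXn2r _ 2) ?nnegrE ?(ltW k0)//; last first.
    by rewrite !mulr_ge0 ?(ltW n0) ?(ltW y0) ?(ltW sy0).
  by apply: le_trans y3; rewrite !exprMn sy2 [y ^+ 3]exprSr mulrA.
have sum2 : \sum_(j <- js) e j ^+ 2 <= kappa * (n * x * Num.sqrt (size js)%:R).
  apply: (@le_trans _ _ (n * (sx * sy) * (n * y))).
    apply: sum_sqr_dev_le => //; first by rewrite !mulr_ge0 ?ltW.
    move=> j; rewrite -(@ler_pXn2r _ 2) ?nnegrE// ?mulr_ge0 ?(ltW n0) ?(ltW sx0) ?(ltW sy0)//.
    rewrite !exprMn sx2 sy2 expr2.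
    apply: le_trans (ler_pM _ _ (absx j) (absy j)) _ => //.
    by rewrite mulrACA expr2.
  rewrite sJ sqrtrV ?(ltW x0)// -/sx.
  rewrite (_ : n * x / sx = n * sx); last by rewrite -sx2; field; rewrite gt_eqF.
  rewrite (_ : _ * _ * _ = n * y * sy * (n * sx)); last by ring.
  by rewrite ler_wpM2r// mulr_ge0 ?ltW.
have lE j : n * x + e j = n * q j by rewrite /e; ring.
have := main _ js (n * x) e t (mulr_gt0 n0 x0).
rewrite lJ => /(_ _ nN _ _ _ sum2 size_ok) pow_le.
apply: (@le_trans _ _ (2 * alpha)%:E).
  rewrite (_ : (fun j => _) = (fun j => cellE (n * x) (n * x + e j))); last first.
    by apply/funext => j; rewrite lE.
  apply: pow_le.
  - by rewrite -(ltr0n R) sJ invr_gt0.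
  - by move=> j; rewrite lE mulr_ge0 ?(ltW n0)// -lee_fin -tilted_massE.
  - by rewrite sumJ -mulr_sumr sumrB u1 (sum_tilted_mass j0 K0) subrr mulr0.
  - by apply: le_trans sum_abs _; rewrite mulrC ler_wpM2r ?(ltW n0).
rewrite /=; case: ifPn => [z0|_]; last exact: leey.
rewrite lee_fin ler_pM2l//; exact: level_le_quantile.
Qed.
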